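(* There is an absolute constant $C>0$ such that the following holds. Suppose $P$ is weakly communicating, let $s_0\in\mathcal S$ be arbitrary, $\eta=1/n$ and $\xi\in(0,1/n]$. Let $\widehat\pi$ be a (deterministic, Markov) Blackwell-optimal policy of the average-reward MDP $(\underline{\widehat P},\widetilde r)$. Then for every $\delta\in(0,1)$, with probability at least $1-\delta$, $$\rho^\star-\rho^{\widehat\pi}\le\sqrt{\frac{C\log^3\!\big(\frac{SAn}{\delta\xi}\big)}{n}\Big(\|h^\star\|_{\mathrm{sp}}+\|\underline h^{\widehat\pi}\|_{\mathrm{sp}}+1\Big)}\;\mathbf 1 .$$
   Context: $\mathcal S$ finite with $S$ states, $\mathcal A$ finite with $A$ actions; transition kernel $P$; known reward $r:\mathcal S\times\mathcal A\to[0,1]$. Policies stationary Markov; $P_\pi,r_\pi$ the induced transition matrix and reward. Empirical kernel $\widehat P$: $n$ i.i.d. samples from each $P(\cdot|s,a)$, independent across pairs, $\widehat P(s'|s,a)$ = fraction equal to $s'$. Anchored kernels: $\underline{\widehat P}(s'|s,a)=(1-\eta)\widehat P(s'|s,a)+\eta\mathbb 1\{s'=s_0\}$ and $\underline P(s'|s,a)=(1-\eta)P(s'|s,a)+\eta\mathbb 1\{s'=s_0\}$. Perturbed reward $\widetilde r=r+\Delta$ with $\Delta(s,a)$ i.i.d. Uniform$[0,\xi]$, independent of the samples. Gain $\rho^\pi=P^\infty_\pi r_\pi$ ($P^\infty_\pi$ Cesàro limit of $P_\pi^t$), bias $h^\pi=\mathrm{C\text{-}lim}_T\sum_{t<T}(P_\pi^tr_\pi-\rho^\pi)$.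 A deterministic policy is Blackwell-optimal for a model $(Q,\tilde r)$ if it maximizes $(I-\gamma Q_\pi)^{-1}\tilde r_\pi$ simultaneously over all policies for all $\gamma$ in some interval $[\bar\gamma,1)$. $\rho^\star,h^\star$: gain and bias of a Blackwell-optimal policy of $(P,r)$. $\underline h^{\pi}$: bias of $\pi$ in $(\underline P,r)$ (true anchored kernel, unperturbed reward). $\|x\|_{\mathrm{sp}}=\max_sx(s)-\min_sx(s)$. Weakly communicating: states split into states transient under every stationary policy and a set where every state is reachable from every other. *)

(* Defs.v *)
From HB Require Import structures.
From mathcomp Require Import all_boot all_order all_algebra.
From mathcomp Require Import all_classical all_reals all_analysis.

Set Implicit Arguments.
Unset Strict Implicit.
Unset Printing Implicit Defensive.

Import Order.TTheory GRing.Theory Num.Theory.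
Import numFieldNormedType.Exports.

Local Open Scope classical_set_scope.
Local Open Scope ring_scope.

Section MDP.
Variables (R : realType) (S A : finType).

Definition kernel_ok (Q : S -> A -> S -> R) : Prop :=
  forall s a, (forall s', 0 <= Q s a s') /\ \sum_(s' : S) Q s a s' = 1.

Definition spolicy_ok (mu : S -> A -> R) : Prop :=
  forall s, (forall a, 0 <= mu s a) /\ \sum_(a : A) mu s a = 1.

Definition det (pi : S -> A) : S -> A -> R :=
  fun s a => if a == pi s then 1 else 0.

Definition Pmu (Q : S -> A -> S -> R) (mu : S -> A -> R) : S -> S -> R :=
  fun s s' => \sum_(a : A) mu s a * Q s a s'.
Definition rmu (r : S -> A -> R) (mu : S -> A -> R) : S -> R :=
  fun s => \sum_(a : A) mu s a * r s a.

Definition mapp (M : S -> S -> R) (v : S -> R) : S -> R :=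
  fun s => \sum_(s' : S) M s s' * v s'.

Definition mpow (M : S -> S -> R) (t : nat) (v : S -> R) : S -> R :=
  iter t (mapp M) v.

(* Discounted value (I - g M)^{-1} v, written as its Neumann series. *)
Definition disc_value (g : R) (M : S -> S -> R) (v : S -> R) : S -> R :=
  fun s => lim ((fun N : nat => \sum_(t < N) g ^+ t * mpow M t v s) @ \oo).

Definition gain (M : S -> S -> R) (v : S -> R) : S -> R :=
  fun s => lim ((fun T : nat => T%:R^-1 * \sum_(t < T) mpow M t v s) @ \oo).

Definition bias (M : S -> S -> R) (v : S -> R) : S -> R :=
  fun s => lim ((fun N : nat => N%:R^-1 *
     \sum_(T < N) \sum_(t < T) (mpow M t v s - gain M v s)) @ \oo).

Definition pgain (Q : S -> A -> S -> R) (r : S -> A -> R) (mu : S -> A -> R) :=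
  gain (Pmu Q mu) (rmu r mu).
Definition pbias (Q : S -> A -> S -> R) (r : S -> A -> R) (mu : S -> A -> R) :=
  bias (Pmu Q mu) (rmu r mu).

Definition blackwell_optimal (Q : S -> A -> S -> R) (r : S -> A -> R)
    (pi : S -> A) : Prop :=
  exists gbar : R, 0 <= gbar < 1 /\
    forall g : R, gbar <= g < 1 ->
    forall mu, spolicy_ok mu -> forall s,
      disc_value g (Pmu Q mu) (rmu r mu) s
        <= disc_value g (Pmu Q (det pi)) (rmu r (det pi)) s.

(* Reachability in a Markov chain M: (M^t)(s, s') > 0 for some t. *)
Definition reach (M : S -> S -> R) (s s' : S) : Prop :=
  exists t, 0 < mpow M t (fun x => if x == s' then 1 else 0) s.

Definition transient (M : S -> S -> R) (s : S) : Prop :=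
  exists s', reach M s s' /\ ~ reach M s' s.

Definition weakly_communicating (Q : S -> A -> S -> R) : Prop :=
  exists C : {set S},
    (forall s s', s \in C -> s' \in C ->
       exists mu, spolicy_ok mu /\ reach (Pmu Q mu) s s') /\
    (forall s, s \notin C ->
       forall mu, spolicy_ok mu -> transient (Pmu Q mu) s).

(* Span seminorm max_s v s - min_s v s. *)
Definition spnorm (v : S -> R) : R :=
  \big[Num.max/0]_(s : S) \big[Num.max/0]_(s' : S) (v s - v s').

Definition anchor (eta : R) (s0 : S) (Q : S -> A -> S -> R) : S -> A -> S -> R :=
  fun s a s' => (1 - eta) * Q s a s' + eta * (if s' == s0 then 1 else 0).

Definition empirical (n : nat) (X : S -> A -> 'I_n -> S) : S -> A -> S -> R :=
  fun s a s' => #|[set i : 'I_n | X s a i == s']|%:R / n%:R.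

End MDP.

Definition prob {R : realType} {d} {T : measurableType d}
  (Pr : probability T R) (E : set T) : R := fine (Pr E).

Arguments kernel_ok {R S A}. Arguments spolicy_ok {R S A}. Arguments det {R S A}.
Arguments Pmu {R S A}. Arguments rmu {R S A}. Arguments mapp {R S}.
Arguments mpow {R S}. Arguments disc_value {R S}. Arguments gain {R S}.
Arguments bias {R S}. Arguments pgain {R S A}. Arguments pbias {R S A}.
Arguments blackwell_optimal {R S A}. Arguments reach {R S}.
Arguments transient {R S}. Arguments weakly_communicating {R S A}.
Arguments spnorm {R S}. Arguments anchor {R S A}. Arguments empirical {R S A}.

(* Main.v *)
Require Import Defs.
From HB Require Import structures.
From mathcomp Require Import all_boot all_order all_algebra.
From mathcomp Require Import all_classical all_reals all_analysis.
From mathcomp Require Import ring lra.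
Import Order.TTheory GRing.Theory Num.Theory.
Import numFieldNormedType.Exports.
Local Open Scope classical_set_scope.
Local Open Scope ring_scope.
Set Implicit Arguments.
Unset Strict Implicit.
Unset Printing Implicit Defensive.

(** Anchoring with weight [1/n] turns average-reward quantities into discounted
    ones: the bias of a policy in the anchored model is, up to a constant, its
    value at discount [1 - 1/n], and a Blackwell-optimal policy of the anchored
    empirical model is optimal for the discounted empirical model.

    Rounding the perturbations down to multiples of [xi/K] makes the sample
    space finite.  Outside an event of small probability two things happen.
    First, no state has two actions with nearly equal optimal values; then the
    optimal policy outside [s] is that of the model in which [s] is absorbing
    with value [u], for some [u] in a fixed finite grid, hence is a function of
    data independent of the samples at [s].  Second, a Chernoff bound therefore
    controls the sampling error at [s] against the true value of the plug-in
    policy, and likewise against [h*].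

    The sampling errors are summed along trajectories of the empirical chain
    by a quadratic Lyapunov function: the variance of an almost invariant
    vector [v] is a drift of [v^2], so only its span enters. *)

(** * Stochastic matrices and Cesàro limits *)

(** The obstacle is that [pihat] is computed from all the samples, so the sampling error at a state
    cannot be tested against the value of [pihat] as if that vector were fixed, and a union bound
    over all policies would cost a factor of order [#|S|]. The vector tested is the value in the
    true model, which depends on the data only through the policy. The absence of near ties makes
    the optimal policy off [s] insensitive to small errors in [u], so a grid of about [2 / th]
    points is enough, and its size enters only through a logarithm. The absorbing model says nothing
    about the action at [s] itself; a union over actions supplies it. No measurability of [pihat] is
    involved: the good event is a union of cells of the discretized data, and on it the bound holds
    for every Blackwell-optimal choice. The argument produces a single power of the logarithm, which
    is at least 1/2 as soon as there are two actions, so it is bounded by four times the cube. *)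

Section Stochastic.
Variables (R : realType) (S : finType).
Implicit Types (M : S -> S -> R) (u v x : S -> R).

Definition stoch M : Prop :=
  forall s, (forall s', 0 <= M s s') /\ \sum_(s' : S) M s s' = 1.

Lemma mappD M u v s :
  mapp M (fun s' => u s' + v s') s = mapp M u s + mapp M v s.
Proof. by rewrite /mapp -big_split /=; apply: eq_bigr => i _; rewrite mulrDr. Qed.

Lemma mappZ M (c : R) v s : mapp M (fun s' => c * v s') s = c * mapp M v s.
Proof. by rewrite /mapp mulr_sumr; apply: eq_bigr => i _; rewrite mulrCA. Qed.

Lemma mappN M v s : mapp M (fun s' => - v s') s = - mapp M v s.
Proof. by rewrite /mapp -sumrN; apply: eq_bigr => i _; rewrite mulrN. Qed.

Lemma mappB M u v s :
  mapp M (fun s' => u s' - v s') s = mapp M u s - mapp M v s.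
Proof. by rewrite mappD mappN. Qed.

Lemma mapp_cst M (c : R) s : stoch M -> mapp M (fun=> c) s = c.
Proof. by move=> /(_ s)[_ h]; rewrite /mapp -mulr_suml h mul1r. Qed.

Lemma ler_mapp M u v s :
  stoch M -> (forall s', u s' <= v s') -> mapp M u s <= mapp M v s.
Proof.
by move=> /(_ s)[h _] uv; apply: ler_sum => i _; apply: ler_wpM2l.
Qed.

Lemma mapp_le M v (c : R) s :
  stoch M -> (forall s', v s' <= c) -> mapp M v s <= c.
Proof. by move=> sM h; rewrite -(mapp_cst c s sM); apply: ler_mapp. Qed.

Lemma mapp_ge M v (c : R) s :
  stoch M -> (forall s', c <= v s') -> c <= mapp M v s.
Proof. by move=> sM h; rewrite -[leLHS](mapp_cst c s sM); apply: ler_mapp. Qed.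

Lemma mapp_norm M v (c : R) s :
  stoch M -> (forall s', `|v s'| <= c) -> `|mapp M v s| <= c.
Proof.
move=> sM h; rewrite ler_norml mapp_ge ?mapp_le // => s';
  by have := h s'; rewrite ler_norml => /andP[].
Qed.

Lemma mpowS M t v : mpow M t.+1 v = mapp M (mpow M t v).
Proof. by []. Qed.

Lemma mpowSr M t v : mpow M t.+1 v = mpow M t (mapp M v).
Proof. by rewrite /mpow iterSr. Qed.

Lemma mpow_norm M v (c : R) t s :
  stoch M -> (forall s', `|v s'| <= c) -> `|mpow M t v s| <= c.
Proof.
by move=> sM h; elim: t s => [|t IH] s //; rewrite mpowS; exact: mapp_norm.
Qed.

Lemma mpowD M t u v s :
  mpow M t (fun s' => u s' + v s') s = mpow M t u s + mpow M t v s.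
Proof.
elim: t s => [//|t IH] s; rewrite !mpowS -mappD; congr mapp.
exact/funext.
Qed.

Lemma mpowN M t v s : mpow M t (fun s' => - v s') s = - mpow M t v s.
Proof.
elim: t s => [//|t IH] s; rewrite !mpowS -mappN; congr mapp.
exact/funext.
Qed.

Lemma mpow_fix M t v s : (forall s', mapp M v s' = v s') -> mpow M t v s = v s.
Proof.
by move=> /funext fx; elim: t => [//|t IH]; rewrite mpowSr fx.
Qed.

Lemma exists_argmax (x : S -> R) (s0 : S) : exists m, forall s, x s <= x m.
Proof.
by exists [arg max_(i > s0) x i]%O => s; case: arg_maxP => // i _; apply.
Qed.

Lemma exists_argmin (x : S -> R) (s0 : S) : exists m, forall s, x m <= x s.
Proof.
have [m hm] := exists_argmax (fun s => - x s) s0.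
by exists m => s; have := hm s; rewrite lerN2.
Qed.

Lemma exists_bound (x : S -> R) : exists2 c, 0 <= c & forall s, `|x s| <= c.
Proof.
exists (\sum_s `|x s|) => [|s]; first by apply: sumr_ge0.
by rewrite (bigD1 s) //= lerDl sumr_ge0.
Qed.

(** At a maximizer [m] of [x] one has [mapp M x m <= x m], hence [x m * (1 - g) <= c]. Such
    comparisons stand in for the inverse of [I - g M]. *)
Lemma max_principle M (g c : R) x s :
  stoch M -> 0 <= g < 1 -> (forall s', x s' <= g * mapp M x s' + c) ->
  x s <= c / (1 - g).
Proof.
move=> sM /andP[g0 g1] h.
have [m hm] := exists_argmax x s.
rewrite ler_pdivlMr ?subr_gt0 //.
apply: (@le_trans _ _ (x m * (1 - g))).
  by apply: ler_wpM2r (hm s); rewrite subr_ge0 ltW.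
have := h m; have : g * mapp M x m <= g * x m.
  by apply: ler_wpM2l => //; exact: mapp_le.
lra.
Qed.

Lemma min_principle M (g c : R) x s :
  stoch M -> 0 <= g < 1 -> (forall s', g * mapp M x s' + c <= x s') ->
  c / (1 - g) <= x s.
Proof.
move=> sM g01 h; rewrite -lerN2 -mulNr.
apply: (@max_principle M g (- c) (fun s => - x s) s) => // s'.
by rewrite mappN; have := h s'; lra.
Qed.

Lemma norm_principle M (g c : R) x s :
  stoch M -> 0 <= g < 1 -> (forall s', `|x s' - g * mapp M x s'| <= c) ->
  `|x s| <= c / (1 - g).
Proof.
move=> sM g01 h; rewrite ler_norml; apply/andP; split.
  rewrite -mulNr; apply: (min_principle s sM g01) => s'.
  by have := h s'; rewrite ler_norml => /andP[]; lra.
apply: (max_principle s sM g01) => s'.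
by have := h s'; rewrite ler_norml => /andP[]; lra.
Qed.

Lemma fixpoint_unique M (g : R) v x y :
  stoch M -> 0 <= g < 1 ->
  (forall s, x s = v s + g * mapp M x s) ->
  (forall s, y s = v s + g * mapp M y s) -> x = y.
Proof.
move=> sM g01 hx hy; apply/funext => s; apply/eqP; rewrite -subr_eq0 -normr_le0.
have -> : (0 : R) = 0 / (1 - g) by rewrite mul0r.
apply: (@norm_principle M g 0 (fun s => x s - y s) s sM g01) => s'.
by rewrite mappB {1}hx {1}hy normr_le0; apply/eqP; ring.
Qed.

Lemma cvg_mapp M (f : S -> nat -> R) v s :
  (forall s', f s' @ \oo --> v s') ->
  (fun N => mapp M (f ^~ N) s) @ \oo --> mapp M v s.
Proof.
move=> cf; rewrite /mapp; apply: cvg_big => [|s' _].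
  exact: add_continuous.
by apply: cvgMl_tmp; exact: cf.
Qed.

Lemma disc_value_cvg M (g : R) v s : stoch M -> 0 <= g < 1 ->
  cvgn (fun N : nat => \sum_(t < N) g ^+ t * mpow M t v s).
Proof.
move=> sM /andP[g0 g1].
have [c c0 hc] := exists_bound v.
rewrite (_ : (fun N => _) = series (fun t => g ^+ t * mpow M t v s)); last first.
  by apply/funext => N; rewrite /series /= big_mkord.
apply: normed_cvg.
apply: (@series_le_cvg R _ (geometric c g)).
- by move=> n /=.
- by move=> n; rewrite geometric_ge0.
- move=> n /=; rewrite normrM normrX (ger0_norm g0) mulrC.
  by apply: ler_wpM2r; [exact: exprn_ge0 | exact: mpow_norm].
- by apply: is_cvg_geometric_series; rewrite ger0_norm.
Qed.

Lemma disc_valueE M (g : R) v s : stoch M -> 0 <= g < 1 ->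
  disc_value g M v s = v s + g * mapp M (disc_value g M v) s.
Proof.
move=> sM g01.
set f := fun s N => \sum_(t < N) g ^+ t * mpow M t v s.
have cf s' : f s' @ \oo --> disc_value g M v s' by exact: disc_value_cvg.
have e N : f s N.+1 = v s + g * mapp M (f ^~ N) s.
  rewrite /f big_ord_recl /= expr0 mul1r; congr (_ + _).
  under eq_bigr do rewrite /bump /= add1n exprS.
  rewrite /mapp mulr_sumr.
  under [RHS]eq_bigr do rewrite mulr_sumr mulr_sumr.
  rewrite exchange_big /=; apply: eq_bigr => t _.
  rewrite /mapp mulr_sumr; apply: eq_bigr => s' _; rewrite -/(mpow M t v).
  by ring.
have c1 : (fun N => f s N.+1) @ \oo --> disc_value g M v s.
  by move: (cf s); rewrite -(cvg_shiftS (f s)).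
have c2 : (fun N => f s N.+1) @ \oo --> v s + g * mapp M (disc_value g M v) s.
  under eq_fun do rewrite e.
  apply: cvgD; first exact: cvg_cst.
  by apply: cvgMl_tmp; apply: cvg_mapp.
exact: (cvg_unique _ c1 c2).
Qed.

End Stochastic.

(** [I - M] on [{ffun S -> R^o}], a finite-dimensional vector space, so that kernel, image and the
    rank formula apply. *)
Definition defect (R : realType) (S : finType) (M : S -> S -> R)
    (v : {ffun S -> R^o}) : {ffun S -> R^o} :=
  [ffun s => v s - mapp M v s].

Lemma defect_linear (R : realType) (S : finType) (M : S -> S -> R) :
  linear (defect M).
Proof.
move=> a u v; apply/ffunP => s; rewrite !ffunE.
have -> : mapp M (a *: u + v) s = a * mapp M u s + mapp M v s.
  by rewrite -mappZ -mappD; congr mapp; apply/funext => i; rewrite !ffunE.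
by rewrite /GRing.scale /=; ring.
Qed.

HB.instance Definition _ (R : realType) (S : finType) (M : S -> S -> R) :=
  GRing.isLinear.Build R {ffun S -> R^o} {ffun S -> R^o} *:%R (defect M)
    (@defect_linear R S M).

(** * Ergodic decomposition, Poisson equation and bounds on the gain *)

Section Ergodic.
Variables (R : realType) (S : finType).
Implicit Types (M : S -> S -> R) (u v x y g : S -> R).

Lemma archi_le0 (a c : R) : (forall T : nat, T%:R * a <= c) -> a <= 0.
Proof.
move=> h; rewrite leNgt; apply/negP => a0.
have := h (Num.bound `|c / a|); apply/negP; rewrite -ltNge -ltr_pdivrMr //.
by apply: le_lt_trans (ler_norm _) (archi_boundP _).
Qed.

Lemma sum_mpow_defect M y s T :
  \sum_(t < T) mpow M t (fun s' => y s' - mapp M y s') s = y s - mpow M T y s.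
Proof.
elim: T => [|T IH]; first by rewrite big_ord0 subrr.
rewrite big_ord_recr /= IH mpowD mpowN -mpowSr -mpowS; ring.
Qed.

(* The kernel and the range of [I - M] only meet at 0: if [x = y - M y] is
   invariant then [y - M^T y = T x] stays bounded.  Rank-nullity concludes. *)
Lemma ergodic_decomposition M v : stoch M ->
  exists g y, (forall s, mapp M g s = g s) /\
              (forall s, v s = g s + (y s - mapp M y s)).
Proof.
move=> sM.
pose f := linfun (defect M).
have fE w s : f w s = w s - mapp M w s by rewrite lfunE /= ffunE.
have dis : (lker f :&: limg f = 0)%VS.
  apply/eqP; rewrite -subv0; apply/subvP => x.
  rewrite memv_cap memv_ker memv0 => /andP[/eqP fx0 /memv_imgP[y _ xy]].
  have [c c0 hc] := exists_bound y.
  have Mx s : mapp M x s = x s.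
    by apply/esym/eqP; rewrite -subr_eq0 -fE fx0 ffunE.
  have xE s : x s = y s - mapp M y s by rewrite xy fE.
  have bd s T : `|T%:R * x s| <= c + c.
    have <- : \sum_(t < T) mpow M t (fun s' => y s' - mapp M y s') s = T%:R * x s.
      rewrite (eq_bigr (fun=> x s)) ?sumr_const ?card_ord ?mulr_natl // => t _.
      rewrite -[RHS](@mpow_fix _ _ M t x) //; congr mpow.
      by apply/funext => s'; rewrite xE.
    rewrite sum_mpow_defect; apply: le_trans (ler_normB _ _) _.
    by apply: lerD => //; exact: mpow_norm.
  apply/eqP/ffunP => s; rewrite ffunE; apply/eqP; rewrite -normr_le0.
  apply: (@archi_le0 _ (c + c)) => T.
  by have := bd s T; rewrite normrM ger0_norm.
have full : (lker f + limg f)%VS = fullv.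
  apply/eqP; rewrite eqEdim subvf /= dimv_disjoint_sum //.
  by rewrite -(limg_ker_dim f fullv) capfv.
pose w : {ffun S -> R^o} := [ffun s => v s].
have /memv_addP[g gk [x /memv_imgP[y _ xy] wE]] : w \in (lker f + limg f)%VS.
  by rewrite full memvf.
exists g, y; split => s.
  by apply/esym/eqP; rewrite -subr_eq0 -fE; move: gk; rewrite memv_ker => /eqP ->; rewrite ffunE.
have := congr1 (fun h : {ffun S -> R^o} => h s) wE.
by rewrite /= !ffunE xy fE => ->.
Qed.

Lemma cvg_bounded_over_n (u : R^nat) (c : R) :
  (forall T, `|u T| <= c) -> (fun T : nat => T%:R^-1 * u T) @ \oo --> (0 : R).
Proof.
move=> hu; rewrite -(cvg_shiftS (fun T : nat => T%:R^-1 * u T)).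
have h0 : (fun n => c * @harmonic R n) @ \oo --> (0 : R).
  by rewrite -(mulr0 c); apply: cvgMl_tmp; exact: cvg_harmonic.
apply: norm_cvg0; apply: (@squeeze_cvgr _ _ _ _ (cst 0) (fun n => c * @harmonic R n)).
- near=> n; rewrite normr_ge0 /= normrM mulrC normfV [`|_.+1%:R|]ger0_norm ?ler0n //.
  by rewrite ler_wpM2r ?invr_ge0.
- exact: cvg_cst.
- exact: h0.
Unshelve. all: by end_near. Qed.

Lemma cvg_gain M v g y : stoch M -> (forall s, mapp M g s = g s) ->
  (forall s, v s = g s + (y s - mapp M y s)) -> forall s,
  (fun T : nat => T%:R^-1 * \sum_(t < T) mpow M t v s) @ \oo --> g s.
Proof.
move=> sM Mg vE s.
have [c c0 hc] := exists_bound y.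
rewrite -(cvg_shiftS (fun T : nat => T%:R^-1 * \sum_(t < T) mpow M t v s)).
rewrite (_ : (fun _ => _) = fun T : nat =>
    g s + (T.+1%:R^-1 * (y s - mpow M T.+1 y s))); last first.
  apply/funext => T.
  rewrite -sum_mpow_defect (_ : v = fun s => g s + (y s - mapp M y s)); last exact/funext.
  under eq_bigr do rewrite mpowD mpow_fix //.
  rewrite big_split /= sumr_const card_ord mulrDr -[g s *+ _]mulr_natl mulrA mulVf ?mul1r //.
rewrite -[g s in X in _ --> X]addr0; apply: cvgD; first exact: cvg_cst.
rewrite (cvg_shiftS (fun T : nat => T%:R^-1 * (y s - mpow M T y s))).
apply: (@cvg_bounded_over_n _ (c + c)) => T.
apply: le_trans (ler_normB _ _) _.
by apply: lerD => //; exact: mpow_norm.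
Qed.

Lemma gainE M v g y : stoch M -> (forall s, mapp M g s = g s) ->
  (forall s, v s = g s + (y s - mapp M y s)) -> gain M v = g.
Proof.
move=> sM Mg vE; apply/funext => s; apply/cvg_lim => //.
exact: cvg_gain Mg vE s.
Qed.

Lemma gain_fix M v s : stoch M -> mapp M (gain M v) s = gain M v s.
Proof.
move=> sM; have [g [y [Mg vE]]] := ergodic_decomposition v sM.
by rewrite (gainE sM Mg vE).
Qed.

(** Decompose twice, [v = g + (I - M) y] and [y = k + (I - M) z]. The centered partial sums
    telescope to [y - M^T y], and [M^T y] has Cesàro limit [k], so the bias is [y - k]. *)
Lemma bias_poisson M v s : stoch M ->
  v s = gain M v s + (bias M v s - mapp M (bias M v) s).
Proof.
move=> sM; have [g [y [Mg vE]]] := ergodic_decomposition v sM.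
have [k [z [Mk yE]]] := ergodic_decomposition y sM.
have gE := gainE sM Mg vE.
suff -> : bias M v = fun s => y s - k s.
  by rewrite mappB gE vE Mk; ring.
apply/funext => s'; apply/cvg_lim => //.
rewrite -(cvg_shiftS (fun N : nat =>
  N%:R^-1 * \sum_(T < N) \sum_(t < T) (mpow M t v s' - gain M v s'))).
rewrite (_ : (fun _ => _) = fun N : nat =>
    y s' - N.+1%:R^-1 * (\sum_(t < N.+1) mpow M t y s')); last first.
  apply/funext => N.
  under eq_bigr => T _.
    under eq_bigr => t _.
      rewrite gE -(@mpow_fix _ _ M t g s') // -mpowN -mpowD.
      rewrite (_ : (fun _ => _) = fun s => y s - mapp M y s); last first.
        by apply/funext => x; rewrite vE; ring.
      over.
    rewrite sum_mpow_defect; over.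
  rewrite sumrB sumr_const card_ord mulrBr -[y s' *+ _]mulr_natl mulrA mulVf ?mul1r //.
apply: cvgB; first exact: cvg_cst.
rewrite (cvg_shiftS (fun N : nat => N%:R^-1 * (\sum_(t < N) mpow M t y s'))).
exact: cvg_gain Mk yE s'.
Qed.

(** With [v = g + (I - M) y], the defect of [z = x - y] is at most [g - c], which every power of [M]
    fixes. Telescoping bounds [T * (c - g s)] by [M^T z - z], which is bounded in [T]. *)
Lemma gain_ge M v x (c : R) s : stoch M ->
  (forall s', x s' - mapp M x s' + c <= v s') -> c <= gain M v s.
Proof.
move=> sM h; have [g [y [Mg vE]]] := ergodic_decomposition v sM.
rewrite (gainE sM Mg vE) -subr_le0.
pose z s := x s - y s.
have [k k0 hk] := exists_bound z.
have zE s' T : T%:R * (c - g s') <= mpow M T z s' - z s'.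
  have -> : mpow M T z s' - z s' =
      - \sum_(t < T) mpow M t (fun s' => z s' - mapp M z s') s'.
    rewrite (sum_mpow_defect M z); ring.
  have -> : T%:R * (c - g s') = \sum_(t < T) (c - g s').
    by rewrite sumr_const card_ord mulr_natl.
  rewrite -sumrN; apply: ler_sum => t _.
  rewrite -mpowN.
  elim: (nat_of_ord t) s' => [|m IH] s'.
    by rewrite /= /z mappB; have := h s'; rewrite vE; lra.
  rewrite mpowS -(Mg s') -(mapp_cst c s' sM) -mappB; exact: ler_mapp.
apply: (@archi_le0 _ (k + k)) => T; apply: le_trans (zE s T) _.
apply: le_trans (ler_norm _) _; apply: le_trans (ler_normB _ _) _.
by apply: lerD => //; exact: mpow_norm.
Qed.

Lemma gain_le M v (c : R) s : stoch M -> (forall s', v s' <= c) -> gain M v s <= c.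
Proof.
move=> sM h; have [g [y [Mg vE]]] := ergodic_decomposition v sM.
have gN : gain M (fun s => - v s) = fun s => - g s.
  apply: (@gainE _ _ _ (fun s => - y s)) => // s'; rewrite !mappN ?Mg //.
  by rewrite vE; ring.
rewrite (gainE sM Mg vE) -lerN2 -[- g s](congr1 (fun f => f s) gN).
apply: (@gain_ge _ _ (fun=> 0)) => // s'.
by rewrite (mapp_cst _ _ sM) subrr add0r lerN2.
Qed.

(** Leading term of the Laurent expansion at discount 1, with a remainder uniform in [g]: once
    [k / (1 - g)] and [y] are removed, the discounted defect is [- (1 - g) * mapp M y], whose factor
    cancels the one lost in [norm_principle]. *)
Lemma disc_value_laurent M v : stoch M ->
  exists2 c, 0 <= c & forall (g : R) s, 0 <= g < 1 ->
    `|disc_value g M v s - gain M v s / (1 - g)| <= c.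
Proof.
move=> sM; have [k [y [Mk vE]]] := ergodic_decomposition v sM.
have [c c0 hc] := exists_bound y.
exists (c + c) => [|g s g01]; first exact: addr_ge0.
have g1 : 1 - g != 0 by rewrite subr_eq0 eq_sym; case/andP: g01 => _ /lt_eqF ->.
rewrite (gainE sM Mk vE).
set W := disc_value g M v.
have bw : `|W s - k s / (1 - g) - y s| <= c.
  have -> : c = ((1 - g) * c) / (1 - g) by field.
  apply: (@norm_principle _ _ M g _ (fun s => W s - k s / (1 - g) - y s)) => // s'.
  rewrite !mappB.
  have -> : mapp M (fun s => k s / (1 - g)) s' = k s' / (1 - g).
    rewrite mulrC -Mk -mappZ; congr mapp; apply/funext => s1; exact: mulrC.
  rewrite {1}/W disc_valueE // -/W vE.
  rewrite (_ : _ - _ - _ - _ = - (1 - g) * mapp M y s'); last by field.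
  have g1p : 0 <= 1 - g by lra.
  rewrite normrM normrN (ger0_norm g1p).
  by apply: ler_wpM2l => //; exact: mapp_norm.
rewrite -[X in `|X|](subrK (y s)); apply: le_trans (ler_normD _ _) _.
by apply: lerD.
Qed.

End Ergodic.

(** * Optimal policies *)

Section Control.
Variables (R : realType) (S A : finType).
Implicit Types (Q : S -> A -> S -> R) (r : S -> A -> R) (pi : S -> A).
Implicit Types (v V : S -> R).

(** Freezing the action gives a stochastic matrix, so the lemmas on [mapp] apply. *)
Definition qapp Q v (s : S) (a : A) : R := mapp (fun x => Q x a) v s.

Definition dval (g : R) Q r pi : S -> R :=
  disc_value g (Pmu Q (det pi)) (rmu r (det pi)).

Definition bellman (g : R) Q r pi V : Prop :=
  (forall s, V s = r s (pi s) + g * qapp Q V s (pi s)) /\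
  (forall s a, r s a + g * qapp Q V s a <= V s).

Lemma stoch_row Q a : kernel_ok Q -> stoch (fun x => Q x a).
Proof. by move=> kQ s; exact: kQ. Qed.

Lemma sum_det pi s (F : A -> R) : \sum_a det pi s a * F a = F (pi s).
Proof.
rewrite (bigD1 (pi s)) //= /det eqxx mul1r big1 ?addr0 // => a /negbTE ->.
by rewrite mul0r.
Qed.

Lemma Pmu_det Q pi : Pmu Q (det pi) = fun s s' => Q s (pi s) s'.
Proof. by apply/funext => s; apply/funext => s'; rewrite /Pmu sum_det. Qed.

Lemma rmu_det r pi : rmu r (det pi) = fun s => r s (pi s).
Proof. by apply/funext => s; rewrite /rmu sum_det. Qed.

Lemma mapp_det Q pi v s : mapp (Pmu Q (det pi)) v s = qapp Q v s (pi s).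
Proof. by rewrite Pmu_det. Qed.

Lemma det_ok pi : spolicy_ok (det pi : S -> A -> R).
Proof.
move=> s; split=> [a|]; first by rewrite /det; case: ifP.
by under eq_bigr do rewrite -[det _ _ _]mulr1; rewrite sum_det.
Qed.

Lemma Pmu_stoch Q (mu : S -> A -> R) : kernel_ok Q -> spolicy_ok mu ->
  stoch (Pmu Q mu).
Proof.
move=> kQ kmu s; split=> [s'|].
  by apply: sumr_ge0 => a _; apply: mulr_ge0; [case: (kmu s) | case: (kQ s a)].
rewrite /Pmu exchange_big /= -[RHS](proj2 (kmu s)); apply: eq_bigr => a _.
by rewrite -mulr_sumr (proj2 (kQ s a)) mulr1.
Qed.

Lemma det_stoch Q pi : kernel_ok Q -> stoch (Pmu Q (det pi)).
Proof. by move=> kQ; apply: Pmu_stoch => //; exact: det_ok. Qed.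

Lemma mapp_Pmu Q (mu : S -> A -> R) v s :
  mapp (Pmu Q mu) v s = \sum_a mu s a * qapp Q v s a.
Proof.
rewrite /mapp /Pmu; under eq_bigr do rewrite mulr_suml.
rewrite exchange_big /=; apply: eq_bigr => a _.
by rewrite mulr_sumr; apply: eq_bigr => s' _; rewrite mulrA.
Qed.

Lemma dvalE g Q r pi s : kernel_ok Q -> 0 <= g < 1 ->
  dval g Q r pi s = r s (pi s) + g * qapp Q (dval g Q r pi) s (pi s).
Proof.
move=> kQ g01; rewrite {1}/dval disc_valueE //; last exact: det_stoch.
by rewrite mapp_det -/(dval g Q r pi) rmu_det.
Qed.

Lemma dval_unique g Q r pi V : kernel_ok Q -> 0 <= g < 1 ->
  (forall s, V s = r s (pi s) + g * qapp Q V s (pi s)) -> V = dval g Q r pi.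
Proof.
move=> kQ g01 hV.
apply: (@fixpoint_unique _ _ (Pmu Q (det pi)) g (rmu r (det pi))) => //.
- exact: det_stoch.
- by move=> s; rewrite mapp_det rmu_det; exact: hV.
- by move=> s; rewrite mapp_det rmu_det; exact: dvalE.
Qed.

(** Switching to [a] at [s] makes [W] a subsolution of the evaluation equation of the new policy;
    the maximum principle along the new chain gives [W <= W']. *)
Lemma policy_improvement g Q r pi s a : kernel_ok Q -> 0 <= g < 1 ->
  dval g Q r pi s < r s a + g * qapp Q (dval g Q r pi) s a ->
  exists pi', (forall x, dval g Q r pi x <= dval g Q r pi' x) /\
              dval g Q r pi s < dval g Q r pi' s.
Proof.
move=> kQ g01 imp; set W := dval g Q r pi in imp *.
pose pi' x := if x == s then a else pi x.
exists pi'; set W' := dval g Q r pi'.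
have le x : W x <= W' x.
  rewrite -subr_le0 -(mul0r (1 - g)^-1).
  apply: (@max_principle _ _ (Pmu Q (det pi')) g 0 (fun x => W x - W' x)) => //.
    exact: det_stoch.
  move=> y; rewrite mapp_det /qapp mappB -!/(qapp _ _ _ _) /W' (dvalE r pi' y) // -/W'.
  suff : W y <= r y (pi' y) + g * qapp Q W y (pi' y) by lra.
  rewrite /pi'; case: eqP => [->|_]; first exact: ltW.
  by rewrite {1}/W dvalE.
split=> //; rewrite /W' (dvalE r pi' s) // -/W' /pi' eqxx -/pi'.
apply: lt_le_trans imp _; rewrite lerD2l; apply: ler_wpM2l; first by case/andP: g01.
by apply: ler_mapp => //; exact: stoch_row.
Qed.

Lemma exists_optimal g Q r (a0 : A) : kernel_ok Q -> 0 <= g < 1 ->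
  exists pi, bellman g Q r pi (dval g Q r pi).
Proof.
move=> kQ g01.
(* Values of two policies need not be comparable pointwise; their sums over states are, and a policy
   maximizing the sum admits no improvement. *)
pose tot (f : {ffun S -> A}) := \sum_s dval g Q r f s.
have [f hf] : exists f, forall f', tot f' <= tot f.
  exists [arg max_(i > [ffun=> a0]) tot i]%O => s.
  by case: arg_maxP => // i _; apply.
exists f; split=> [s|s a]; first exact: dvalE.
rewrite leNgt; apply/negP => /(policy_improvement kQ g01)[pi' [le lt]].
have := hf (finfun pi'); apply/negP; rewrite -ltNge.
have -> : tot (finfun pi') = \sum_s dval g Q r pi' s.
  by apply: eq_bigr => x _; congr dval; apply/funext => y; rewrite ffunE.
rewrite /tot (bigD1 s) //= [ltRHS](bigD1 s) //=.
by apply: ltr_leD => //; exact: ler_sum.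
Qed.

Lemma bellman_le g Q r r' pi pi' V V' (c : R) s : kernel_ok Q -> 0 <= g < 1 ->
  bellman g Q r pi V -> bellman g Q r' pi' V' ->
  (forall s a, r s a <= r' s a + c) -> V s - V' s <= c / (1 - g).
Proof.
move=> kQ g01 [VE _] [_ V'ge] rr'.
apply: (@max_principle _ _ (Pmu Q (det pi)) g c (fun s => V s - V' s)) => //.
  exact: det_stoch.
move=> x; rewrite mapp_det /qapp mappB -!/(qapp _ _ _ _) {1}VE.
have := V'ge x (pi x); have := rr' x (pi x); lra.
Qed.

Lemma bellman_dist g Q r r' pi pi' V V' (c : R) s : kernel_ok Q -> 0 <= g < 1 ->
  bellman g Q r pi V -> bellman g Q r' pi' V' ->
  (forall s a, `|r s a - r' s a| <= c) -> `|V s - V' s| <= c / (1 - g).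
Proof.
move=> kQ g01 bV bV' rr'; rewrite ler_norml; apply/andP; split; last first.
  apply: (bellman_le s kQ g01 bV bV') => x a.
  by have := rr' x a; rewrite ler_norml; lra.
rewrite lerNl opprB; apply: (bellman_le s kQ g01 bV' bV) => x a.
by have := rr' x a; rewrite ler_norml; lra.
Qed.

Lemma blackwell_bellman Q r pi : kernel_ok Q -> blackwell_optimal Q r pi ->
  exists2 gbar : R, 0 <= gbar < 1 & forall g, gbar <= g < 1 ->
    bellman g Q r pi (dval g Q r pi).
Proof.
move=> kQ [gbar [gb01 opt]]; exists gbar => // g hg.
have g01 : 0 <= g < 1 by lra.
split=> [s|s a]; first exact: dvalE.
rewrite leNgt; apply/negP => /(policy_improvement kQ g01)[pi' [_]].
apply/negP; rewrite -leNgt; apply: opt => //; exact: det_ok.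
Qed.

Lemma le_of_affine (a b K e0 : R) : 0 < e0 ->
  (forall e, 0 < e <= e0 -> a <= b + e * K) -> a <= b.
Proof.
move=> e00 h; rewrite leNgt; apply/negP => ba.
pose e := Num.min e0 ((a - b) / (2 * (`|K| + 1))).
have K1 : 0 < 2 * (`|K| + 1) by rewrite mulr_gt0 // ltr_wpDl.
have ep : 0 < e by rewrite lt_min e00 divr_gt0 ?subr_gt0.
have ee0 : e <= e0 by rewrite ge_min lexx.
have ee : e <= (a - b) / (2 * (`|K| + 1)) by rewrite ge_min lexx orbT.
have := h e; rewrite ep ee0 => /(_ isT).
have : e * K <= e * (`|K| + 1).
  by apply: ler_wpM2l; [exact: ltW | have := ler_norm K; lra].
move: ee; rewrite ler_pdivlMr //; lra.
Qed.

(** Multiply the Bellman inequality at discount [1 - e] by [e] and let [e] tend to 0: by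
    [disc_value_laurent], only the gain survives. *)
Lemma gain_superharmonic Q r pi s a : kernel_ok Q -> blackwell_optimal Q r pi ->
  qapp Q (pgain Q r (det pi)) s a <= pgain Q r (det pi) s.
Proof.
move=> kQ /(blackwell_bellman kQ)[gbar gb01 opt].
have sM := det_stoch pi kQ.
have [c c0 hc] := disc_value_laurent (rmu r (det pi)) sM.
set rho := pgain Q r (det pi).
apply: (@le_of_affine _ _ (qapp Q rho s a - r s a + 2 * c) (1 - gbar)); first lra.
move=> e he; pose g := 1 - e.
have g01 : 0 <= g < 1 by rewrite /g; lra.
have [_ /(_ s a)] := opt g ltac:(rewrite /g; lra).
set W := dval g Q r pi => Wge.
have hW x : `|W x - rho x / e| <= c.
  by have := hc g x g01; rewrite -[e](_ : 1 - g = e) //; rewrite /g; ring.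
have Ws : W s <= rho s / e + c by have := hW s; rewrite ler_norml; lra.
have qW : qapp Q rho s a / e - c <= qapp Q W s a.
  have -> : qapp Q rho s a / e - c = qapp Q (fun x => e^-1 * rho x - c) s a.
    rewrite /qapp mappB mappZ mapp_cst ?(mulrC e^-1) //; exact: stoch_row.
  apply: ler_mapp; first exact: stoch_row.
  by move=> x; have := hW x; rewrite ler_norml mulrC; lra.
have e0 : 0 < e by lra.
have key : r s a + g * (qapp Q rho s a / e - c) <= rho s / e + c.
  apply: le_trans Ws; apply: le_trans Wge.
  by rewrite lerD2l; apply: ler_wpM2l => //; lra.
have := ler_wpM2l (ltW e0) key.
have -> : e * (r s a + g * (qapp Q rho s a / e - c)) =
  e * r s a + g * qapp Q rho s a - e * g * c by field; rewrite gt_eqF.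
have -> : e * (rho s / e + c) = rho s + e * c by field; rewrite gt_eqF.
have : e * g * c <= e * c.
  by apply: ler_wpM2r => //; rewrite -[leRHS]mulr1; apply: ler_wpM2l; lra.
rewrite /g; lra.
Qed.

End Control.

(** * Closed sets and recurrent states *)

Section Recurrence.
Variables (R : realType) (S : finType).
Implicit Types (M : S -> S -> R) (u v : S -> R).

Definition indic (s' : S) : S -> R := fun x => if x == s' then 1 else 0.

Lemma mpow_mono M t u v s :
  stoch M -> (forall s', u s' <= v s') -> mpow M t u s <= mpow M t v s.
Proof.
by move=> sM uv; elim: t s => [|t IH] s //; rewrite !mpowS; exact: ler_mapp.
Qed.

Lemma mpowZ M t (c : R) v s : mpow M t (fun s' => c * v s') s = c * mpow M t v s.
Proof.
elim: t s => [//|t IH] s; rewrite !mpowS -mappZ; congr mapp.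
exact/funext.
Qed.

Lemma indic_ge0 x y : 0 <= indic x y.
Proof. by rewrite /indic; case: ifP. Qed.

Lemma mpow_ge0 M t v s :
  stoch M -> (forall s', 0 <= v s') -> 0 <= mpow M t v s.
Proof.
by move=> sM v0; elim: t s => [|t IH] s //; rewrite mpowS; exact: mapp_ge.
Qed.

Lemma reach_refl M s : reach M s s.
Proof. by exists 0; rewrite /= eqxx ltr01. Qed.

Lemma reach_trans M x y z : stoch M -> reach M x y -> reach M y z -> reach M x z.
Proof.
move=> sM [t ht] [t' ht']; exists (t + t')%N.
rewrite -[fun _ => _]/(indic z) in ht' *; rewrite -[fun _ => _]/(indic y) in ht.
rewrite /mpow iterD -/(mpow M t' (indic z)) -/(mpow M t _).
apply: (@lt_le_trans _ _ (mpow M t (fun s => mpow M t' (indic z) y * indic y s) x)).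
  by rewrite mpowZ mulr_gt0.
apply: mpow_mono => // s; rewrite {2}/indic; case: eqP => [->|_].
  by rewrite mulr1.
by rewrite mulr0; apply: mpow_ge0 => // ?; exact: indic_ge0.
Qed.

Definition closed_under M (F : S -> Prop) : Prop :=
  forall s s', F s -> 0 < M s s' -> F s'.

Lemma closed_reach M (F : S -> Prop) s s' : stoch M -> closed_under M F ->
  F s -> reach M s s' -> F s'.
Proof.
move=> sM cF Fs [t]; rewrite -[fun _ => _]/(indic s').
case: (pselect (F s')) => // nF; suff -> : mpow M t (indic s') s = 0 by rewrite ltxx.
elim: t s Fs => [|t IH] s Fs.
  by rewrite /= /indic; case: eqP => // ss'; case: nF; rewrite -ss'.
rewrite mpowS /mapp big1 // => x _.
have := (sM s).1 x; rewrite le_eqVlt => /orP[/eqP <-|Msx]; first by rewrite mul0r.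
by rewrite IH ?mulr0 //; exact: cF Fs Msx.
Qed.

(* Take a state of the closed set reaching as few states as possible. *)
Lemma exists_recurrent M (F : S -> Prop) s : stoch M -> closed_under M F ->
  F s -> exists2 x, F x & ~ transient M x.
Proof.
move=> sM cF; pose rs x := [pred y | `[< reach M x y >]].
have [k] := ubnP #|rs s|; elim: k s => // k IH s; rewrite ltnS => hk Fs.
case: (pselect (transient M s)) => [[s' [ss' ns's]]|nt]; last by exists s.
apply: (IH s'); last exact: closed_reach Fs ss'.
apply: leq_trans hk; apply: proper_card; apply/fintype.properP; split.
  apply/fintype.subsetP => y /asboolW s'y.
  by apply/asboolT; exact: (reach_trans sM ss' s'y).
exists s; first by apply/asboolT; exact: reach_refl.
by apply/negP => /asboolW.
Qed.

(** Equality case of the maximum principle; it makes the maximizers of an invariant function a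
    closed set. *)
Lemma mapp_eq_max M v (c : R) s x : stoch M -> (forall y, v y <= c) ->
  c <= mapp M v s -> 0 < M s x -> v x = c.
Proof.
move=> sM vc cM Mx; apply/eqP; rewrite eq_le vc /= -(ler_pM2l Mx) -subr_ge0.
apply: (@le_trans _ _ (mapp M v s - c)); first by rewrite subr_ge0.
rewrite -[in leLHS](mapp_cst c s sM) -mappB /mapp (bigD1 x) //= -mulrBr.
rewrite gerDl; apply: sumr_le0 => y _; apply: mulr_ge0_le0; first exact: (sM s).1.
by rewrite subr_le0.
Qed.

End Recurrence.

Section WeaklyCommunicating.
Variables (R : realType) (S A : finType).
Implicit Types (Q : S -> A -> S -> R) (r : S -> A -> R) (pi : S -> A).

(* The minimizers of the gain form a set closed under every policy, its
   maximizers a set closed under [pi]; both contain non-transient states. *)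
Lemma blackwell_gain_const Q r pi s s' : kernel_ok Q ->
  weakly_communicating Q -> blackwell_optimal Q r pi ->
  pgain Q r (det pi) s = pgain Q r (det pi) s'.
Proof.
move=> kQ [C [Creach Ctrans]] opt.
set rho := pgain Q r (det pi).
have super x a : qapp Q rho x a <= rho x by exact: gain_superharmonic.
have superm (mu : S -> A -> R) x : spolicy_ok mu -> mapp (Pmu Q mu) rho x <= rho x.
  move=> kmu; rewrite mapp_Pmu -[leRHS]mul1r -(proj2 (kmu x)) mulr_suml.
  by apply: ler_sum => a _; apply: ler_wpM2l => //; exact: (kmu x).1.
have [y hy] := exists_argmax rho s; have [z hz] := exists_argmin rho s.
pose Y x := rho x = rho y; pose Z x := rho x = rho z.
have sM := det_stoch pi kQ.
have cY : closed_under (Pmu Q (det pi)) Y.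
  move=> x x' Yx; apply: (mapp_eq_max sM hy).
  by rewrite -Yx /rho /pgain (gain_fix _ _ sM).
have cZ mu : spolicy_ok mu -> closed_under (Pmu Q mu) Z.
  move=> kmu x x' Zx Mx; apply: oppr_inj.
  apply: (@mapp_eq_max _ _ (Pmu Q mu) (fun x => - rho x) _ x) => //.
  - exact: Pmu_stoch.
  - by move=> w; rewrite lerN2.
  - by rewrite mappN lerN2 -Zx; exact: superm.
have inC x : ~ transient (Pmu Q (det pi)) x -> x \in C.
  by move=> nt; case: (boolP (x \in C)) => // /Ctrans/(_ _ (det_ok R pi)).
have [y' Yy' /inC y'C] := exists_recurrent sM cY (erefl : Y y).
have [z' Zz' /inC z'C] := exists_recurrent sM (cZ _ (det_ok R pi)) (erefl : Z z).
(* The minimizers are closed under [mu] as well, so [mu] leads from one of them to the maximizer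
   [y'] without leaving them. *)
have [mu [kmu zy]] := Creach _ _ z'C y'C.
have Zy' : Z y' := closed_reach (Pmu_stoch kQ kmu) (cZ _ kmu) Zz' zy.
have yz : rho y = rho z by rewrite -Yy' Zy'.
have all x : rho x = rho y by apply/eqP; rewrite eq_le hy /= yz hz.
by rewrite !all.
Qed.

End WeaklyCommunicating.

(** * Anchoring as discounting *)

Section Anchor.
Variables (R : realType) (S A : finType).
Implicit Types (Q : S -> A -> S -> R) (r : S -> A -> R) (pi : S -> A).

Lemma qapp_anchor (eta : R) s0 Q v s a :
  qapp (anchor eta s0 Q) v s a = (1 - eta) * qapp Q v s a + eta * v s0.
Proof.
rewrite /qapp /mapp /anchor.
under eq_bigr do rewrite mulrDl -!mulrA.
rewrite big_split /= -!mulr_sumr; congr (_ + _ * _).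
rewrite (bigD1 s0) //= eqxx mul1r big1 ?addr0 // => i /negbTE ->.
by rewrite mul0r.
Qed.

Lemma anchor_ok (eta : R) s0 Q : 0 <= eta <= 1 -> kernel_ok Q ->
  kernel_ok (anchor eta s0 Q).
Proof.
move=> e01 kQ s a; split=> [s'|].
  apply: addr_ge0; apply: mulr_ge0; [lra | exact: (kQ s a).1 | lra |].
  by case: ifP.
have := qapp_anchor eta s0 Q (fun=> 1) s a.
rewrite /qapp (mapp_cst 1 s (stoch_row a kQ)) /mapp.
by under eq_bigr do rewrite mulr1; move=> ->; ring.
Qed.

(** Jumps to [s0] add only the constant [eta * h s0] to the Poisson equation, which becomes the
    equation at discount [1 - eta] once a shift of [h] absorbs this constant and the gain. *)
Lemma pbias_anchor (eta : R) s0 Q r pi : 0 < eta <= 1 -> kernel_ok Q ->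
  exists c, forall s,
    pbias (anchor eta s0 Q) r (det pi) s = dval (1 - eta) Q r pi s + c.
Proof.
move=> e01 kQ; have kA := @anchor_ok eta s0 Q ltac:(lra) kQ.
have sM := det_stoch pi kA; set M := Pmu _ _ in sM.
have g01 : 0 <= 1 - eta < 1 by lra.
pose g := gain M (rmu r (det pi)).
(* The anchored gain is constant: [g - g s0] is fixed by [1 - eta] times a stochastic matrix. *)
have gc s : g s = g s0.
  apply/eqP; rewrite -subr_eq0 -normr_le0 -(mul0r (1 - (1 - eta))^-1).
  apply: (@norm_principle _ _ _ (1 - eta) 0 (fun s => g s - g s0) s (det_stoch pi kQ) g01).
  move=> s'; rewrite normr_le0 mapp_det /qapp mappB mapp_cst; last exact: stoch_row.
  rewrite -/(qapp Q g s' (pi s')).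
  have <- : mapp M g s' = g s' by exact: gain_fix.
  by rewrite mapp_det qapp_anchor; apply/eqP; ring.
have e0 : eta != 0 by rewrite gt_eqF; lra.
pose h := bias M (rmu r (det pi)).
pose c := h s0 - g s0 / eta.
exists c => s; rewrite -(@dval_unique _ _ _ _ Q r pi (fun s => h s - c)) ?subrK // => x.
rewrite /qapp mappB mapp_cst; last exact: stoch_row.
rewrite -/(qapp Q h x (pi x)).
have := bias_poisson (rmu r (det pi)) x sM.
rewrite -/h -/g gc mapp_det qapp_anchor rmu_det => ->.
by rewrite /c; field.
Qed.

(* With discount [g], the anchored value is the value of the original kernel
   with discount [g (1 - eta)] up to an additive constant. *)
Lemma anchor_bellman (eta : R) s0 Q r pi : 0 < eta <= 1 -> kernel_ok Q ->
  blackwell_optimal (anchor eta s0 Q) r pi ->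
  bellman (1 - eta) Q r pi (dval (1 - eta) Q r pi).
Proof.
move=> e01 kQ opt; have kA := @anchor_ok eta s0 Q ltac:(lra) kQ.
have g01 : 0 <= 1 - eta < 1 by lra.
split=> [s|s a]; first exact: dvalE.
have [gbar gb01 hb] := blackwell_bellman kA opt.
set V := dval (1 - eta) Q r pi.
have [B B0 hB] := exists_bound V.
(* Replacing [V'] by [V] costs [e * B / eta] twice, outside and inside [qapp]; replacing the
   discount [g'] by [1 - eta] costs [e * B]. *)
apply: (@le_of_affine _ _ _ (2 * (B / eta) + B) (1 - gbar)) => [|e he]; first lra.
pose g := 1 - e; pose g' := g * (1 - eta).
have gg : gbar <= g < 1 by rewrite /g; lra.
have g'eta : eta <= 1 - g'.
  have : 0 <= e * (1 - eta) by apply: mulr_ge0; lra.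
  by rewrite /g' /g; lra.
have g'0 : 0 <= g' by apply: mulr_ge0; lra.
have g'01 : 0 <= g' < 1 by lra.
have [WE Wge] := hb g gg; set W := dval _ _ _ _ in WE Wge.
have g'1 : 1 - g' != 0 by rewrite gt_eqF; lra.
pose c := g * eta * W s0 / (1 - g').
have cE : c = g * eta * W s0 + g' * c by rewrite /c; field.
have V'E : (fun s => W s - c) = dval g' Q r pi.
  apply: dval_unique => // x; rewrite /qapp mappB mapp_cst; last exact: stoch_row.
  rewrite -/(qapp Q W x (pi x)) WE qapp_anchor {1}cE /g'; ring.
set V' := dval g' Q r pi in V'E.
have V'ge : r s a + g' * qapp Q V' s a <= V' s.
  rewrite -V'E /qapp mappB mapp_cst; last exact: stoch_row.
  rewrite -/(qapp Q W s a); apply: le_trans (lerB (Wge s a) (lexx c)).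
  by rewrite qapp_anchor {2}cE /g' le_eqVlt; apply/orP; left; apply/eqP; ring.
have qV x b : `|qapp Q V x b| <= B by apply: mapp_norm => //; exact: stoch_row.
have dV x : `|V' x - V x| <= e * B / eta.
  apply: (@le_trans _ _ (e * B / (1 - g'))); last first.
    apply: ler_wpM2l; first by apply: mulr_ge0 => //; lra.
    by rewrite lef_pV2 // posrE; lra.
  apply: (@norm_principle _ _ (Pmu Q (det pi)) g' _ (fun x => V' x - V x)) => //.
    exact: det_stoch.
  move=> y; rewrite mapp_det /qapp mappB -!/(qapp _ _ _ _).
  rewrite /V' dvalE // -/V' /V dvalE // -/V.
  rewrite (_ : _ - _ - _ = - (e * (1 - eta)) * qapp Q V y (pi y)); last first.
    by rewrite /g' /g; ring.
  rewrite normrM normrN; apply: ler_pM => //.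
  rewrite ger0_norm ?mulr_ge0 //; [|lra|lra].
  by rewrite -[leRHS]mulr1; apply: ler_wpM2l; lra.
have dq : qapp Q V s a <= qapp Q V' s a + e * B / eta.
  rewrite -lerBlDl /qapp -mappB; apply: mapp_le; first exact: stoch_row.
  by move=> x; have := dV x; rewrite ler_norml; lra.
have := dV s; rewrite ler_norml => /andP[_ dVs].
have t1 : g' * qapp Q V s a <= g' * (qapp Q V' s a + e * B / eta).
  exact: ler_wpM2l.
have eBe : 0 <= e * B / eta.
  by rewrite -mulrA; apply: mulr_ge0; [lra | apply: divr_ge0; lra].
have t2 : g' * (e * B / eta) <= e * B / eta.
  by rewrite -[leRHS]mul1r; apply: ler_wpM2r => //; lra.
have t3 : (1 - eta) * qapp Q V s a <= g' * qapp Q V s a + e * B.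
  rewrite -lerBlDl -mulrBl (_ : _ - _ = e * (1 - eta)); last by rewrite /g' /g; ring.
  have /(le_trans (ler_norm _)) qB := qV s a.
  apply: (@le_trans _ _ (e * (1 - eta) * B)).
    by apply: ler_wpM2l => //; apply: mulr_ge0; lra.
  by apply: ler_wpM2r => //; rewrite -[leRHS]mulr1; apply: ler_wpM2l; lra.
have -> : e * (2 * (B / eta) + B) = 2 * (e * B / eta) + e * B by ring.
rewrite -/V; lra.
Qed.

End Anchor.

(** * The quadratic Lyapunov function *)

Section Span.
Variables (R : realType) (S : finType).
Implicit Types (v : S -> R) (p : S -> R).

Lemma spnorm_ge v s s' : v s - v s' <= spnorm v.
Proof.
apply: le_trans (le_bigmax _ _ s).
exact: (le_bigmax _ (fun s' => v s - v s')).
Qed.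

Lemma spnorm_ge0 v : 0 <= spnorm v.
Proof. exact: bigmax_ge_id. Qed.

Lemma spnormD v (c : R) : spnorm (fun s => v s + c) = spnorm v.
Proof.
by apply: eq_bigr => s _; apply: eq_bigr => s' _; rewrite opprD addrACA subrr addr0.
Qed.

Lemma spnorm_le v (c : R) : 0 <= c -> (forall s s', v s - v s' <= c) -> spnorm v <= c.
Proof. by move=> c0 h; apply: bigmax_le => // s _; apply: bigmax_le. Qed.

Lemma spnormN v : spnorm (fun s => - v s) = spnorm v.
Proof.
apply/eqP; rewrite eq_le; apply/andP; split;
  apply: spnorm_le => [|s s']; rewrite ?spnorm_ge0 //.
  by rewrite opprK addrC spnorm_ge.
by have := spnorm_ge (fun s => - v s) s' s; lra.
Qed.

(** [v] minus its minimum, written without choosing a minimizer. It takes values between 0 and the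
    span, as needed to use its square as a potential. *)
Definition lowered v : S -> R := fun s => \big[Num.max/0]_(s' : S) (v s - v s').

Lemma loweredE v (s0 : S) : exists m, forall s, lowered v s = v s - v m.
Proof.
have [m hm] := exists_argmin v s0; exists m => s.
apply/eqP; rewrite eq_le; apply/andP; split.
  by apply: bigmax_le => [|s' _]; rewrite ?subr_ge0 // lerD2l lerN2.
exact: (le_bigmax _ (fun s' => v s - v s')).
Qed.

Lemma lowered_ge0 v s : 0 <= lowered v s.
Proof. exact: bigmax_ge_id. Qed.

Lemma lowered_le v s : lowered v s <= spnorm v.
Proof. exact: (le_bigmax _ (lowered v)). Qed.

Definition distr_mean p v : R := \sum_(s : S) p s * v s.

Definition distr_var p v : R := distr_mean p (fun s => v s ^+ 2) - distr_mean p v ^+ 2.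

End Span.

Section Lyapunov.
Variables (R : realType) (S : finType).
Implicit Types (M : S -> S -> R) (v : S -> R).

(* [D + 4 alpha kappa v^2] is the Lyapunov function: since [v] is almost
   invariant under [M], the variance is up to a constant a drift of [v^2]
   along [Mh], so it telescopes. *)
Lemma variance_drift M Mh v (n : nat) (B q alpha kappa c0 : R) (D : S -> R) s :
  (0 < n)%N -> stoch M -> stoch Mh -> 1 <= B -> B <= n%:R -> 0 <= q <= 1 ->
  alpha = q / (2 * B) -> 0 <= kappa <= 1 ->
  (forall s, 0 <= v s <= B) ->
  (forall s, `|v s - mapp M v s| <= 1) ->
  (forall s, distr_mean (Mh s) v - distr_mean (M s) v <= 2 * alpha * distr_var (M s) v + 2 * q) ->
  (forall s, distr_mean (M s) (fun x => v x ^+ 2) - distr_mean (Mh s) (fun x => v x ^+ 2)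
     <= distr_var (M s) v / 2 + 16 * q ^+ 2 * B) ->
  (forall s, D s <= (1 - n%:R^-1) * mapp Mh D s + (c0 + kappa * (mapp Mh v s - mapp M v s))) ->
  D s <= n%:R * (c0 + 40 * q).
Proof.
move=> n0 sM sMh B1 Bn q01 aE k01 vB vM h1 h2 hD.
have nR : 0 < n%:R :> R by rewrite ltr0n.
have n1 : 1 <= n%:R :> R by rewrite ler1n.
have i0 : 0 < n%:R^-1 :> R by rewrite invr_gt0.
have i1 : n%:R^-1 <= 1 :> R by rewrite invf_le1.
have in1 : n%:R * n%:R^-1 = 1 :> R by rewrite mulfV ?gt_eqF.
set i := n%:R^-1 in i0 i1 in1 hD *.
have a0 : 0 <= alpha by rewrite aE; apply: divr_ge0; lra.
have aB : 2 * (alpha * B) = q by rewrite aE; field; rewrite gt_eqF //; lra.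
pose v2 x := v x ^+ 2.
have v2B x : 0 <= v2 x <= B * B.
  rewrite sqr_ge0 /v2 expr2; have := vB x => /andP[v0 vle].
  exact: ler_pM.
(* 19 = 16 + 2 + 1: the second-moment error with [q <= 1], the near invariance of [v], and the
   discounting of [v2 <= B * B] with [B <= n]. *)
have drift x : distr_var (M x) v <= 2 * ((1 - i) * mapp Mh v2 x - v2 x + 19 * B).
  have q2B : q ^+ 2 * B <= B.
    rewrite -[leRHS]mul1r; apply: ler_wpM2r; first lra.
    by rewrite expr_le1 //; lra.
  have m2B : i * mapp Mh v2 x <= B.
    apply: (@le_trans _ _ (i * (n%:R * B))); last by rewrite mulrA (mulrC i) in1 mul1r.
    apply: ler_wpM2l; first exact: ltW.
    apply: mapp_le => // y; have := v2B y => /andP[_ /le_trans]; apply.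
    by apply: ler_wpM2r => //; lra.
  have sq : v2 x - mapp M v x ^+ 2 <= 2 * B.
    rewrite /v2 subr_sqr; have := vM x; have := vB x.
    have : 0 <= mapp M v x <= B.
      by apply/andP; split; [apply: mapp_ge | apply: mapp_le] => // y; have := vB y => /andP[].
    move=> /andP[m0 mB] /andP[v0 vle] hv.
    apply: le_trans (ler_norm _) _; rewrite normrM.
    apply: (@le_trans _ _ (1 * (2 * B))); last by rewrite mul1r.
    apply: ler_pM => //; rewrite ger0_norm; lra.
  have h2x : mapp M v2 x - mapp Mh v2 x <=
    (mapp M v2 x - mapp M v x ^+ 2) / 2 + 16 * q ^+ 2 * B := h2 x.
  suff : mapp M v2 x - mapp M v x ^+ 2 <=
    2 * ((1 - i) * mapp Mh v2 x - v2 x + 19 * B) by [].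
  lra.
pose a := 4 * alpha * kappa.
have ak0 : 0 <= alpha * kappa by apply: mulr_ge0; lra.
have a00 : 0 <= a by rewrite /a; lra.
have g01 : 0 <= 1 - i < 1 by lra.
have step x : D x + a * v2 x <=
    (1 - i) * mapp Mh (fun x => D x + a * v2 x) x + (c0 + 40 * q).
  rewrite mappD mappZ.
  (* The constant terms add up to [4 * 19 * (alpha * B) + 2 * q = 38 * q + 2 * q], since [alpha * B]
     is half of [q]. *)
  have dif : mapp Mh v x - mapp M v x <=
      4 * alpha * ((1 - i) * mapp Mh v2 x - v2 x) + 40 * q.
    apply: le_trans (h1 x) _.
    have := ler_wpM2l a0 (drift x).
    have -> : alpha * (2 * ((1 - i) * mapp Mh v2 x - v2 x + 19 * B)) =
      2 * alpha * ((1 - i) * mapp Mh v2 x - v2 x) + 19 * (2 * (alpha * B)) by ring.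
    rewrite aB; lra.
  have k0 : 0 <= kappa by lra.
  have := ler_wpM2l k0 dif.
  have -> : kappa * (4 * alpha * ((1 - i) * mapp Mh v2 x - v2 x) + 40 * q) =
    a * ((1 - i) * mapp Mh v2 x - v2 x) + kappa * (40 * q) by rewrite /a; ring.
  have : kappa * (40 * q) <= 40 * q.
    by rewrite -[leRHS]mul1r; apply: ler_wpM2r; lra.
  have := hD x; lra.
have := max_principle s sMh g01 step.
have -> : (c0 + 40 * q) / (1 - (1 - i)) = n%:R * (c0 + 40 * q).
  by rewrite opprB addrCA subrr addr0 /i invrK mulrC.
apply: le_trans; rewrite lerDl; apply: mulr_ge0 => //.
by have := v2B s => /andP[].
Qed.

End Lyapunov.

(** * From concentration to suboptimality *)

Section Deterministic.
Variables (R : realType) (S A : finType).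
Implicit Types (Q : S -> A -> S -> R) (r : S -> A -> R) (pi : S -> A).
Implicit Types (p : S -> R) (v h : S -> R).

(** The variance of an almost invariant [v] averages to order [spnorm v + 1] along trajectories;
    this is the Bernstein deviation at that average variance. *)
Definition bernstein_rate (L : R) (n : nat) v : R :=
  Num.sqrt (L * (spnorm v + 1) / n%:R).

(* Bernstein's inequality linearized by AM-GM, and a lower bound on the second
   moment; void when the target bound exceeds 1. *)
Definition concentrated (L : R) (n : nat) p ph v : Prop :=
  L * (spnorm v + 1) <= n%:R ->
  let q := bernstein_rate L n v in
  distr_mean ph (lowered v) - distr_mean p (lowered v)
    <= 2 * (q / (2 * (spnorm v + 1))) * distr_var p (lowered v) + 2 * q /\
  distr_mean p (fun x => lowered v x ^+ 2) - distr_mean ph (fun x => lowered v x ^+ 2)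
    <= distr_var p (lowered v) / 2 + 16 * q ^+ 2 * (spnorm v + 1).

Lemma bernstein_rate01 L n v : (0 < n)%N -> L * (spnorm v + 1) <= n%:R ->
  0 <= bernstein_rate L n v <= 1.
Proof.
move=> n0 h; rewrite sqrtr_ge0 -sqrtr1 ler_wsqrtr //.
by rewrite ler_pdivrMr ?mul1r // ltr0n.
Qed.

Lemma inv_natr_bounds (n : nat) : (0 < n)%N ->
  [/\ 0 < n%:R^-1 :> R, n%:R^-1 <= 1 :> R & n%:R * n%:R^-1 = 1 :> R].
Proof.
move=> n0; have nR : 0 < n%:R :> R by rewrite ltr0n.
split; first by rewrite invr_gt0.
  by rewrite invf_le1 // ler1n.
by rewrite mulfV ?gt_eqF.
Qed.

Lemma empirical_value_lower P Ph r pi (rho : R) h U (n : nat) (L : R) x :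
  kernel_ok P -> kernel_ok Ph -> (0 < n)%N -> 1 <= L ->
  (forall s a, 0 <= r s a <= 1) -> 0 <= rho <= 1 ->
  (forall s, rho + h s = r s (pi s) + qapp P h s (pi s)) ->
  (forall s, r s (pi s) + (1 - n%:R^-1) * qapp Ph U s (pi s) <= U s) ->
  L * (spnorm h + 1) <= n%:R ->
  (forall s, concentrated L n (P s (pi s)) (Ph s (pi s)) (fun x => - h x)) ->
  rho * n%:R - (spnorm h + 1) -
    40 * (n%:R * bernstein_rate L n (fun x => - h x)) <= U x.
Proof.
move=> kP kPh n0 L1 r01 rho01 poisson hU LB hc.
rewrite -(spnormN h) in LB *; set h' := (fun x => - h x) in LB hc *.
have [m wE] := loweredE h' x.
set B := spnorm h' + 1 in LB *.
have B1 : 1 <= B by rewrite /B; have := spnorm_ge0 h'; lra.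
have Bn : B <= n%:R.
  by apply: le_trans LB; rewrite -[leLHS]mul1r; apply: ler_wpM2r; lra.
have q01 := bernstein_rate01 n0 LB.
have wB y : 0 <= lowered h' y <= B.
  by rewrite lowered_ge0 /=; apply: le_trans (lowered_le _ _) _; rewrite /B; lra.
have hE y : h y = h m - lowered h' y by rewrite wE /h'; ring.
have Pw y : qapp P h y (pi y) = h m - qapp P (lowered h') y (pi y).
  rewrite -(mapp_cst (h m) y (stoch_row (pi y) kP)) /qapp -mappB; congr mapp.
  exact/funext.
have [i0 i1 ni] := inv_natr_bounds n0.
set i := n%:R^-1 in hU i0 i1 ni.
have D : rho * n%:R - lowered h' x - U x <= n%:R * (0 + 40 * bernstein_rate L n h').
  apply: (@variance_drift R S (Pmu P (det pi)) (Pmu Ph (det pi)) (lowered h') n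
    B _ _ 1 0 (fun y => rho * n%:R - lowered h' y - U y)) => //.
  - exact: det_stoch.
  - exact: det_stoch.
  - by rewrite ler01 lexx.
  - move=> y; rewrite mapp_det; have := poisson y; rewrite Pw hE => po.
    by have := r01 y (pi y); rewrite ler_norml; clear -rho01 po; lra.
  - by move=> y; rewrite !Pmu_det; have [] := hc y LB.
  - by move=> y; rewrite !Pmu_det; have [] := hc y LB.
  move=> y; rewrite !mapp_det add0r mul1r -/i.
  have -> : qapp Ph (fun y => rho * n%:R - lowered h' y - U y) y (pi y) =
      rho * n%:R - qapp Ph (lowered h') y (pi y) - qapp Ph U y (pi y).
    by rewrite /qapp !mappB mapp_cst //; exact: stoch_row.
  have := poisson y; rewrite Pw hE => po.
  have := hU y.
  have : 0 <= i * qapp Ph (lowered h') y (pi y).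
    apply: mulr_ge0; first exact: ltW.
    by apply: mapp_ge; [exact: stoch_row | move=> z; exact: lowered_ge0].
  have -> : (1 - i) * (rho * n%:R - qapp Ph (lowered h') y (pi y) - qapp Ph U y (pi y)) =
    rho * n%:R - rho * (n%:R * i) - (1 - i) * qapp Ph (lowered h') y (pi y)
    - (1 - i) * qapp Ph U y (pi y) by ring.
  by rewrite ni; clear -po; lra.
have := wB x; clear -D; rewrite add0r in D; lra.
Qed.

Lemma dval_bounds P r pi (n : nat) x : kernel_ok P -> (0 < n)%N ->
  (forall s a, 0 <= r s a <= 1) -> 0 <= dval (1 - n%:R^-1) P r pi x <= n%:R.
Proof.
move=> kP n0 r01; have [i0 i1 ni] := inv_natr_bounds n0.
set i := n%:R^-1 in i0 i1 ni *; have g01 : 0 <= 1 - i < 1 by lra.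
set V := dval _ _ _ _.
have VE y : V y = r y (pi y) + (1 - i) * qapp P V y (pi y) by exact: dvalE.
apply/andP; split.
  rewrite -(mul0r (1 - (1 - i))^-1).
  apply: (min_principle _ (det_stoch pi kP) g01) => y.
  by rewrite mapp_det addr0 [leRHS]VE lerDr; have /andP[] := r01 y (pi y).
have -> : n%:R = 1 / (1 - (1 - i)).
  by rewrite opprB addrCA subrr addr0 mul1r /i invrK.
apply: (max_principle _ (det_stoch pi kP) g01) => y.
by rewrite mapp_det [leLHS]VE addrC lerD2l; have /andP[] := r01 y (pi y).
Qed.

(** Apply [variance_drift] to [U - V]: the perturbation contributes [1/n] per step, and
    [V - P V = r - P V / n] lies in [[-1, 1]] because [0 <= V <= n]. *)
Lemma empirical_value_upper P Ph r rt pi (n : nat) (L : R) x :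
  kernel_ok P -> kernel_ok Ph -> (0 < n)%N -> 1 <= L ->
  (forall s a, 0 <= r s a <= 1) ->
  (forall s a, rt s a <= r s a + n%:R^-1) ->
  let V := dval (1 - n%:R^-1) P r pi in
  L * (spnorm V + 1) <= n%:R ->
  (forall s, concentrated L n (P s (pi s)) (Ph s (pi s)) V) ->
  dval (1 - n%:R^-1) Ph rt pi x - V x <= 1 + 40 * (n%:R * bernstein_rate L n V).
Proof.
move=> kP kPh n0 L1 r01 rt01 V LB hc.
have V01 y : 0 <= V y <= n%:R by exact: dval_bounds.
have [i0 i1 ni] := inv_natr_bounds n0.
set i := n%:R^-1 in i0 i1 ni V LB hc V01 rt01 *.
have g01 : 0 <= 1 - i < 1 by lra.
set U := dval _ Ph _ _.
have VE y : V y = r y (pi y) + (1 - i) * qapp P V y (pi y) by exact: dvalE.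
have UE y : U y = rt y (pi y) + (1 - i) * qapp Ph U y (pi y) by exact: dvalE.
have [m wE] := loweredE V x.
set B := spnorm V + 1 in LB *.
have B1 : 1 <= B by rewrite /B; have := spnorm_ge0 V; lra.
have Bn : B <= n%:R.
  by apply: le_trans LB; rewrite -[leLHS]mul1r; apply: ler_wpM2r; lra.
have q01 := bernstein_rate01 n0 LB.
have wB y : 0 <= lowered V y <= B.
  by rewrite lowered_ge0 /=; apply: le_trans (lowered_le _ _) _; rewrite /B; lra.
have qw Q y : kernel_ok Q -> qapp Q V y (pi y) = V m + qapp Q (lowered V) y (pi y).
  move=> kQ; rewrite -(mapp_cst (V m) y (stoch_row (pi y) kQ)) /qapp -mappD.
  by congr mapp; apply/funext => z; rewrite wE; ring.
have -> : 1 + 40 * (n%:R * bernstein_rate L n V) =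
    n%:R * (i + 40 * bernstein_rate L n V) by rewrite mulrDr ni; ring.
apply: (@variance_drift R S (Pmu P (det pi)) (Pmu Ph (det pi)) (lowered V) n
  B _ _ (1 - i) i (fun y => U y - V y)) => //.
- exact: det_stoch.
- exact: det_stoch.
- by clear -i0 i1; lra.
- move=> y; rewrite mapp_det.
  have : 0 <= i * qapp P V y (pi y) <= 1.
    have : 0 <= qapp P V y (pi y) <= n%:R.
      apply/andP; split; [apply: mapp_ge | apply: mapp_le];
        by [exact: stoch_row | move=> z; have /andP[] := V01 z].
    move=> /andP[p0 pn]; rewrite mulr_ge0 //=; last exact: ltW.
    by rewrite -ni mulrC ler_wpM2r // ltW.
  have := VE y; have := wE y; have := qw P y kP.
  by have := r01 y (pi y); rewrite ler_norml; clear; lra.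
- by move=> y; rewrite !Pmu_det; have [] := hc y LB.
- by move=> y; rewrite !Pmu_det; have [] := hc y LB.
move=> y; rewrite !mapp_det.
have -> : qapp Ph (fun y => U y - V y) y (pi y) =
    qapp Ph U y (pi y) - (V m + qapp Ph (lowered V) y (pi y)).
  by rewrite -qw // /qapp mappB.
have := UE y; have := VE y; rewrite (qw P) //.
by have := rt01 y (pi y); rewrite -/i; clear; lra.
Qed.

(** Optimality of [pihat] in the empirical model links the two value bounds, giving [V >= K]. The
    discounted equation then makes [V] a certificate in [gain_ge] for gain at least [K / n]. The
    loss is [80 * q + B / n + 1 / n], and each of the last two terms is at most [q]. *)
Lemma plugin_suboptimality P Ph r rt pistar pihat (rho : R) h (n : nat) (L : R) s :
  kernel_ok P -> kernel_ok Ph -> (0 < n)%N -> 1 <= L ->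
  (forall s a, 0 <= r s a <= 1) ->
  (forall s a, r s a <= rt s a <= r s a + n%:R^-1) ->
  0 <= rho <= 1 ->
  (forall s, rho + h s = r s (pistar s) + qapp P h s (pistar s)) ->
  bellman (1 - n%:R^-1) Ph rt pihat (dval (1 - n%:R^-1) Ph rt pihat) ->
  let V := dval (1 - n%:R^-1) P r pihat in
  L * (spnorm h + spnorm V + 1) <= n%:R ->
  (forall s, concentrated L n (P s (pistar s)) (Ph s (pistar s)) (fun x => - h x)) ->
  (forall s, concentrated L n (P s (pihat s)) (Ph s (pihat s)) V) ->
  rho - pgain P r (det pihat) s
    <= 82 * Num.sqrt (L * (spnorm h + spnorm V + 1) / n%:R).
Proof.
move=> kP kPh n0 L1 r01 rt01 rho01 poisson [_ Uge] V LBn ch cV.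
have [i0 i1 ni] := inv_natr_bounds n0.
have sh0 := spnorm_ge0 h; have sV0 := spnorm_ge0 V.
set B := spnorm h + spnorm V + 1 in LBn *.
have hB : spnorm h + 1 <= B by rewrite /B; lra.
have VB : spnorm V + 1 <= B by rewrite /B; lra.
have B1 : 1 <= B by lra.
have L0 : 0 <= L by lra.
have BL : B <= L * B by rewrite -[leLHS]mul1r; apply: ler_wpM2r; lra.
set q := Num.sqrt _.
have qle v : spnorm v + 1 <= B -> bernstein_rate L n v <= q.
  move=> vB; rewrite ler_wsqrtr //.
  by apply: ler_wpM2r; [exact: ltW | exact: ler_wpM2l].
have low x : rho * n%:R - (spnorm h + 1) -
    40 * (n%:R * bernstein_rate L n (fun x => - h x)) <=
    dval (1 - n%:R^-1) Ph rt pihat x.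
  apply: (@empirical_value_lower P Ph r pistar) => //.
    move=> y; apply: le_trans (Uge y (pistar y)); rewrite lerD2r.
    by have /andP[] := rt01 y (pistar y).
  by apply: le_trans LBn; exact: ler_wpM2l.
have up x : dval (1 - n%:R^-1) Ph rt pihat x - V x <=
    1 + 40 * (n%:R * bernstein_rate L n V).
  apply: empirical_value_upper => //.
    by move=> y a; have /andP[] := rt01 y a.
  by apply: le_trans LBn; exact: ler_wpM2l.
have VE x : V x = r x (pihat x) + (1 - n%:R^-1) * qapp P V x (pihat x).
  by apply: dvalE => //; lra.
set i := n%:R^-1 in i0 i1 ni VE.
have nq v : spnorm v + 1 <= B -> n%:R * bernstein_rate L n v <= n%:R * q.
  by move=> /qle; apply: ler_wpM2l.
have nqh := nq (fun x => - h x); rewrite spnormN in nqh.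
pose K := rho * n%:R - B - 80 * (n%:R * q) - 1.
have VK x : K <= V x.
  have := low x; have := up x; have := nqh hB; have := nq V VB.
  by rewrite /K; clear -hB; lra.
have Bq : B * i <= q.
  have Bi0 : 0 <= B * i by apply: mulr_ge0; lra.
  rewrite -[leLHS](ger0_norm Bi0) -sqrtr_sqr ler_wsqrtr //.
  rewrite -/i expr2 mulrA; apply: ler_wpM2r; first exact: ltW.
  apply: ler_wpM2r; first lra.
  by apply: (@le_trans _ _ 1); rewrite // -ni; apply: ler_wpM2r; lra.
have gK : i * K <= pgain P r (det pihat) s.
  apply: (@gain_ge _ _ _ _ V); first exact: det_stoch.
  move=> y; rewrite mapp_det rmu_det [in leLHS]VE.
  have : i * K <= i * qapp P V y (pihat y).
    by apply: ler_wpM2l; [exact: ltW | apply: mapp_ge => //; exact: stoch_row].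
  by clear; lra.
have KE : i * K = rho * (n%:R * i) - B * i - 80 * (n%:R * i) * q - i.
  by rewrite /K; ring.
rewrite ni in KE.
have : i <= B * i by rewrite -[leLHS]mul1r; apply: ler_wpM2r; lra.
by clear -KE gK Bq; lra.
Qed.

End Deterministic.

(** * Finite product probability spaces *)

Section FiniteProbability.
Variables (R : realType) (O : finType) (w : O -> R).
Hypothesis w0 : forall o, 0 <= w o.
Hypothesis w1 : \sum_o w o = 1.

Definition fprob (G : pred O) : R := \sum_(o | G o) w o.

Lemma fprobE G : fprob G = \sum_o w o * (G o)%:R.
Proof.
rewrite /fprob big_mkcond /=; apply: eq_bigr => o _.
by case: (G o); rewrite ?mulr1 ?mulr0.
Qed.

Lemma fprobC G : fprob (fun o => ~~ G o) = 1 - fprob G.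
Proof. by rewrite -w1 (bigID G) /= addrAC subrr add0r. Qed.

Lemma fprob_mono (G H : pred O) : (forall o, G o -> H o) -> fprob G <= fprob H.
Proof.
move=> GH; rewrite !fprobE; apply: ler_sum => o _; apply: ler_wpM2l => //.
by rewrite ler_nat; case: (boolP (G o)) => // /GH ->.
Qed.

Lemma fprob_union (I : finType) (G : I -> pred O) :
  fprob (fun o => [exists i, G i o]) <= \sum_i fprob (G i).
Proof.
rewrite fprobE; under [leRHS]eq_bigr do rewrite fprobE.
rewrite exchange_big /=; apply: ler_sum => o _; rewrite -mulr_sumr.
apply: ler_wpM2l => //; case: existsP => [[i Gi]|_]; last exact: sumr_ge0.
by rewrite (bigD1 i) //= Gi lerDl sumr_ge0.
Qed.

Lemma fprobU (G H : pred O) : fprob (fun o => G o || H o) <= fprob G + fprob H.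
Proof.
rewrite !fprobE -big_split /=; apply: ler_sum => o _; rewrite -mulrDr.
by apply: ler_wpM2l => //; rewrite -natrD ler_nat; case: (G o); case: (H o).
Qed.

(* [(x, y) |-> (mix x y, mix y x)] is a weight preserving involution. *)
Lemma resample (mix : O -> O -> O) (f : O -> R) :
  (forall x y, mix (mix x y) (mix y x) = x) ->
  (forall x y, w (mix x y) * w (mix y x) = w x * w y) ->
  \sum_o w o * f o = \sum_y w y * \sum_x w x * f (mix x y).
Proof.
move=> mixK wmix.
pose sw (p : O * O) := (mix p.1 p.2, mix p.2 p.1).
have swK : involutive sw by case=> x y; rewrite /sw /= !mixK.
transitivity (\sum_(p : O * O) w p.1 * w p.2 * f p.1).
  rewrite -(pair_bigA _ (fun x y => w x * w y * f x)) /=; apply: eq_bigr => x _.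
  rewrite -mulr_suml -mulr_sumr w1 mulr1 //.
rewrite (reindex_inj (inv_inj swK)) /=.
under eq_bigr do rewrite wmix.
rewrite -(pair_bigA _ (fun x y => w x * w y * f (mix x y))) exchange_big /=.
apply: eq_bigr => y _; rewrite mulr_sumr; apply: eq_bigr => x _.
by rewrite mulrCA mulrA.
Qed.

(** Conditioning without conditional probabilities: a bound valid when the coordinates taken from
    [y] are frozen holds unconditionally. *)
Lemma fprob_resample (mix : O -> O -> O) (G : pred O) (c : R) :
  (forall x y, mix (mix x y) (mix y x) = x) ->
  (forall x y, w (mix x y) * w (mix y x) = w x * w y) ->
  (forall y, fprob (fun x => G (mix x y)) <= c) -> fprob G <= c.
Proof.
move=> mixK wmix h; rewrite fprobE (resample _ mixK wmix).
have -> : c = \sum_y w y * c by rewrite -mulr_suml w1 mul1r.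
by apply: ler_sum => y _; apply: ler_wpM2l => //; have := h y; rewrite fprobE.
Qed.

End FiniteProbability.

Section ProductWeight.
Variables (R : realType) (I T : finType) (p : I -> T -> R).
Hypothesis p0 : forall i t, 0 <= p i t.
Hypothesis p1 : forall i, \sum_t p i t = 1.

Definition wprod (x : {ffun I -> T}) : R := \prod_i p i (x i).

Lemma wprod_expect (f : I -> T -> R) :
  \sum_x wprod x * \prod_i f i (x i) = \prod_i \sum_t p i t * f i t.
Proof.
rewrite bigA_distr_bigA /=; apply: eq_bigr => x _.
by rewrite -big_split.
Qed.

Lemma wprod_ge0 x : 0 <= wprod x.
Proof. exact: prodr_ge0. Qed.

Definition ffmix (J : pred I) (x y : {ffun I -> T}) : {ffun I -> T} :=
  [ffun i => if J i then x i else y i].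

Lemma ffmixK J x y : ffmix J (ffmix J x y) (ffmix J y x) = x.
Proof. by apply/ffunP => i; rewrite !ffunE; case: (J i). Qed.

Lemma wprod_ffmix J x y :
  wprod (ffmix J x y) * wprod (ffmix J y x) = wprod x * wprod y.
Proof.
rewrite /wprod -!big_split /=; apply: eq_bigr => i _; rewrite !ffunE.
by case: (J i) => //; rewrite mulrC.
Qed.

End ProductWeight.

(** * Exponential moments *)

Section Chernoff.
Variable (R : realType).

(** Use [expR x <= (1 - x)^-1], a geometric bound. No lower bound on [x] is assumed, so only one
    side of a centered variable has to be controlled. *)
Lemma expR_le_quadratic (x : R) : x <= 2^-1 -> expR x <= 1 + x + 2 * x ^+ 2.
Proof.
move=> hx; have h := expR_ge1Dx (- x).
have pos : 0 < 1 - x by lra.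
rewrite -[expR x]invrK -expRN.
apply: (@le_trans _ _ (1 - x)^-1); first by rewrite lef_pV2 // posrE ?expR_gt0.
rewrite -[leLHS]mul1r ler_pdivrMr //.
have : 0 <= x ^+ 2 * (1 - 2 * x) by apply: mulr_ge0; [exact: sqr_ge0 | lra].
by rewrite (_ : (1 + x + 2 * x ^+ 2) * (1 - x) = 1 + x ^+ 2 * (1 - 2 * x)); [lra | ring].
Qed.

Lemma distr_var_centered (S : finType) (p Y : S -> R) : \sum_s p s = 1 ->
  distr_var p Y = \sum_s p s * (Y s - distr_mean p Y) ^+ 2.
Proof.
move=> p1; set m := distr_mean p Y.
have -> : \sum_s p s * (Y s - m) ^+ 2 =
    \sum_s (p s * Y s ^+ 2 - 2 * m * (p s * Y s) + m ^+ 2 * p s).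
  by apply: eq_bigr => s _; ring.
rewrite big_split sumrB /= -!mulr_sumr p1 -/(distr_mean p Y) -/m /distr_var.
rewrite -/m /distr_mean; ring.
Qed.

Lemma mgf_bound (S : finType) (p Y : S -> R) (lam : R) :
  (forall s, 0 <= p s) -> \sum_s p s = 1 ->
  (forall s, lam * (Y s - distr_mean p Y) <= 2^-1) ->
  \sum_s p s * expR (lam * (Y s - distr_mean p Y))
    <= expR (2 * lam ^+ 2 * distr_var p Y).
Proof.
move=> p0 p1 hY; apply: le_trans (expR_ge1Dx _).
rewrite distr_var_centered //; set m := distr_mean p Y in hY *.
apply: (@le_trans _ _ (\sum_s p s * (1 + lam * (Y s - m) + 2 * (lam * (Y s - m)) ^+ 2))).
  by apply: ler_sum => s _; apply: ler_wpM2l => //; exact: expR_le_quadratic.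
rewrite le_eqVlt; apply/orP; left; apply/eqP.
have -> : \sum_s p s * (1 + lam * (Y s - m) + 2 * (lam * (Y s - m)) ^+ 2) =
  \sum_s ((1 - lam * m) * p s + lam * (p s * Y s)
          + 2 * lam ^+ 2 * (p s * (Y s - m) ^+ 2)).
  by apply: eq_bigr => s _; ring.
rewrite !big_split /= -!mulr_sumr p1 -/(distr_mean p Y) -/m; ring.
Qed.

End Chernoff.

(** * The finite sample space and its empirical kernel *)

Section Model.
Variables (R : realType) (S A : finType) (P : S -> A -> S -> R) (n K : nat).
Hypothesis kP : kernel_ok P.
Hypothesis n0 : (0 < n)%N.
Hypothesis K0 : (0 < K)%N.

Definition outcome : finType :=
  ({ffun S * A * 'I_n -> S} * {ffun S * A -> 'I_K})%type.

Definition weight (o : outcome) : R :=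
  wprod (fun k : S * A * 'I_n => P k.1.1 k.1.2) o.1 *
  wprod (fun (_ : S * A) (_ : 'I_K) => K%:R^-1) o.2.

Definition ehat (o : outcome) : S -> A -> S -> R :=
  empirical n (fun s a i => o.1 (s, a, i)).

Let pX0 (k : S * A * 'I_n) t : 0 <= P k.1.1 k.1.2 t.
Proof. exact: (kP _ _).1. Qed.
Let pX1 (k : S * A * 'I_n) : \sum_t P k.1.1 k.1.2 t = 1.
Proof. exact: (kP _ _).2. Qed.
Let pK0 (j : S * A) (t : 'I_K) : 0 <= K%:R^-1 :> R.
Proof. by rewrite invr_ge0. Qed.
Let pK1 (j : S * A) : \sum_(t < K) K%:R^-1 = 1 :> R.
Proof.
by rewrite sumr_const card_ord -[_ *+ _]mulr_natr mulVf // pnatr_eq0 -lt0n.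
Qed.

Lemma weight_ge0 o : 0 <= weight o.
Proof. by apply: mulr_ge0; apply: wprod_ge0. Qed.

Lemma weight_expect (f : S * A * 'I_n -> S -> R) (g : S * A -> 'I_K -> R) :
  \sum_o weight o * (\prod_k f k (o.1 k) * \prod_j g j (o.2 j)) =
  (\prod_(k : S * A * 'I_n) \sum_t P k.1.1 k.1.2 t * f k t) *
  (\prod_j \sum_t K%:R^-1 * g j t).
Proof.
rewrite -!wprod_expect big_distrlr /= pair_bigA /=.
by apply: eq_bigr => o _; rewrite /weight mulrACA.
Qed.

Lemma weight_sum1 : \sum_o weight o = 1.
Proof.
have /= := weight_expect (fun _ _ => 1) (fun _ _ => 1).
under eq_bigr do rewrite !big1_eq !mulr1.
move=> ->; rewrite big1 => [|k _]; last by under eq_bigr do rewrite mulr1; exact: pX1.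
by rewrite mul1r big1 // => j _; under eq_bigr do rewrite mulr1; exact: pK1.
Qed.

(** Resamples only the transitions drawn at [sa]; all other samples and every perturbation are those
    of [o']. *)
Definition mixX (sa : S * A) (o o' : outcome) : outcome :=
  (ffmix (fun k => k.1 == sa) o.1 o'.1, o'.2).

Definition mixD (sa : S * A) (o o' : outcome) : outcome :=
  (o'.1, ffmix (fun j => j == sa) o.2 o'.2).

Lemma mixXK sa o o' : mixX sa (mixX sa o o') (mixX sa o' o) = o.
Proof. by rewrite /mixX /= ffmixK; case: o. Qed.

Lemma mixDK sa o o' : mixD sa (mixD sa o o') (mixD sa o' o) = o.
Proof. by rewrite /mixD /= ffmixK; case: o. Qed.

Lemma weight_mixX sa o o' :
  weight (mixX sa o o') * weight (mixX sa o' o) = weight o * weight o'.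
Proof. by rewrite /weight /= mulrACA wprod_ffmix mulrACA mulrA mulrAC -!mulrA; ring. Qed.

Lemma weight_mixD sa o o' :
  weight (mixD sa o o') * weight (mixD sa o' o) = weight o * weight o'.
Proof. by rewrite /weight /= mulrACA wprod_ffmix; ring. Qed.

Lemma fprob_uniform (sa : S * A) (G : pred 'I_K) :
  fprob weight (fun o => G (o.2 sa)) = #|G|%:R / K%:R.
Proof.
rewrite fprobE.
have /= := weight_expect (fun _ _ => 1) (fun j t => if j == sa then (G t)%:R else 1).
under eq_bigr do rewrite big1_eq mul1r -big_mkcond big_pred1_eq.
move=> ->; rewrite big1 => [|k _]; last by under eq_bigr do rewrite mulr1; exact: pX1.
rewrite mul1r (bigD1 sa) //= [X in _ * X]big1 => [|j /negbTE jsa]; last first.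
  by under eq_bigr do rewrite jsa mulr1; exact: pK1.
rewrite mulr1 eqxx -mulr_sumr mulrC; congr (_ / _).
by rewrite -natr_sum -sum1_card [in RHS]big_mkcond.
Qed.

Lemma ehat_mean o s a (Y : S -> R) :
  distr_mean (ehat o s a) Y = n%:R^-1 * \sum_(i < n) Y (o.1 (s, a, i)).
Proof.
rewrite /distr_mean /ehat /empirical.
transitivity (\sum_s' \sum_(i < n) n%:R^-1 * ((o.1 (s, a, i) == s')%:R * Y s')).
  apply: eq_bigr => s' _; rewrite -mulr_sumr -mulr_suml mulrAC mulrC; congr (_ * (_ * _)).
  rewrite -natr_sum -sum1_card big_mkcond /=; congr (_%:R); apply: eq_bigr => i _.
  by rewrite unfold_in /= asboolb; case: (_ == _).
rewrite exchange_big /= mulr_sumr; apply: eq_bigr => i _.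
rewrite -mulr_sumr (bigD1 (o.1 (s, a, i))) //= eqxx mul1r big1 ?addr0 // => s'.
by rewrite eq_sym => /negbTE ->; rewrite mul0r.
Qed.

Lemma ehat_ok o : kernel_ok (ehat o).
Proof.
move=> s a; split=> [s'|]; first by rewrite /ehat /empirical divr_ge0.
have := ehat_mean o s a (fun=> 1); rewrite /distr_mean.
under eq_bigr do rewrite mulr1.
rewrite sumr_const card_ord  => ->; rewrite mulVf // pnatr_eq0 -lt0n //.
Qed.

(** Exponential Markov inequality with parameter [n * lam]; the threshold is such that its variance
    term cancels the moment bound and leaves [expR (- L)]. *)
Lemma chernoff s a (Y : S -> R) (lam L : R) : 0 < lam ->
  (forall s', lam * (Y s' - distr_mean (P s a) Y) <= 2^-1) ->
  fprob weight (fun o => 2 * lam * distr_var (P s a) Y + L / (n%:R * lam)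
     < distr_mean (ehat o s a) Y - distr_mean (P s a) Y) <= expR (- L).
Proof.
move=> lam0 hY; set m := distr_mean (P s a) Y in hY *.
set V := distr_var _ _.
have nR : 0 < n%:R :> R by rewrite ltr0n.
pose F (k : S * A * 'I_n) t := if k.1 == (s, a) then expR (lam * (Y t - m)) else 1.
have FE (o : outcome) : \prod_k F k (o.1 k) = expR (n%:R * lam * (distr_mean (ehat o s a) Y - m)).
  have -> : \prod_k F k (o.1 k) = \prod_j \prod_i F (j, i) (o.1 (j, i)).
    by rewrite pair_bigA /=; apply: eq_bigr => -[].
  rewrite (bigD1 (s, a)) //=.
  rewrite [X in _ * X]big1 => [|j /negbTE js]; last by apply: big1 => i _; rewrite /F /= js.
  rewrite mulr1 /F /= eqxx -expR_sum; congr expR.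
  rewrite -mulr_sumr sumrB sumr_const card_ord ehat_mean -mulr_natl.
  by field; rewrite gt_eqF.
have key : \sum_o weight o * \prod_k F k (o.1 k) <= expR (n%:R * (2 * lam ^+ 2 * V)).
  have /= := weight_expect F (fun _ _ => 1).
  under eq_bigr do rewrite big1_eq mulr1.
  move=> ->; rewrite [X in _ * X]big1 => [|j _]; last by under eq_bigr do rewrite mulr1; exact: pK1.
  rewrite mulr1.
  have -> : \prod_(k : S * A * 'I_n) \sum_t P k.1.1 k.1.2 t * F k t =
      \prod_(j : S * A) \prod_(i < n) \sum_t P j.1 j.2 t * F (j, i) t.
    by rewrite pair_bigA /=; apply: eq_bigr => -[].
  rewrite (bigD1 (s, a)) //= [X in _ * X]big1 => [|j /negbTE js]; last first.
    apply: big1 => i _; rewrite /F /= js -[RHS](pX1 (j, i)).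
    by apply: eq_bigr => t _; rewrite mulr1.
  rewrite mulr1 /F /= eqxx prodr_const card_ord expRM_natl.
  apply: lerXn2r; rewrite ?nnegrE ?expR_ge0 //.
    by apply: sumr_ge0 => t _; apply: mulr_ge0; [exact: (kP s a).1 | exact: expR_ge0].
  by apply: mgf_bound => //; [exact: (kP s a).1 | exact: (kP s a).2].
set t := 2 * lam * V + L / (n%:R * lam).
rewrite fprobE.
apply: (@le_trans _ _ (\sum_o weight o * \prod_k F k (o.1 k) * expR (- (n%:R * lam * t)))).
  apply: ler_sum => o _; rewrite -mulrA; apply: ler_wpM2l; first exact: weight_ge0.
  rewrite FE -expRD; case: ltP => [h|_]; last exact: expR_ge0.
  rewrite -expR0 ler_expR -mulrBr; apply: mulr_ge0; last by rewrite subr_ge0 ltW.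
  by rewrite mulr_ge0 // ltW.
rewrite -mulr_suml; apply: (le_trans (ler_wpM2r (expR_ge0 _) key)).
rewrite -expRD ler_expR le_eqVlt; apply/orP; left; apply/eqP; rewrite /t.
by field; rewrite !gt_eqF.
Qed.

End Model.

Section FixedVector.
Variables (R : realType) (S A : finType) (P : S -> A -> S -> R) (n K : nat).
Hypothesis kP : kernel_ok P.
Hypothesis n0 : (0 < n)%N.
Hypothesis K0 : (0 < K)%N.

Lemma distr_mean_le (p Y : S -> R) (c : R) : (forall s, 0 <= p s) ->
  \sum_s p s = 1 -> (forall s, Y s <= c) -> distr_mean p Y <= c.
Proof.
move=> p0 p1 h; rewrite -[leRHS]mul1r -p1 mulr_suml.
by apply: ler_sum => s _; exact: ler_wpM2l.
Qed.

Lemma distr_mean_ge (p Y : S -> R) (c : R) : (forall s, 0 <= p s) ->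
  \sum_s p s = 1 -> (forall s, c <= Y s) -> c <= distr_mean p Y.
Proof.
move=> p0 p1 h; rewrite -[leLHS]mul1r -p1 mulr_suml.
by apply: ler_sum => s _; exact: ler_wpM2l.
Qed.

Lemma distr_meanN (p Y : S -> R) : distr_mean p (fun s => - Y s) = - distr_mean p Y.
Proof. by rewrite /distr_mean -sumrN; apply: eq_bigr => s _; rewrite mulrN. Qed.

(** Squaring is [2 * B]-Lipschitz on [[0, B]]. This turns a deviation bound for second moments into
    one in terms of the variance of [v]. *)
Lemma distr_var_sqr (p v : S -> R) (B : R) : (forall s, 0 <= p s) ->
  \sum_s p s = 1 -> (forall s, 0 <= v s <= B) ->
  distr_var p (fun s => - v s ^+ 2) <= 4 * B ^+ 2 * distr_var p v.
Proof.
move=> p0 p1 vB; rewrite [in leRHS]distr_var_centered //.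
set m := distr_mean p v.
have mB : 0 <= m <= B.
  by apply/andP; split; [apply: distr_mean_ge | apply: distr_mean_le] => // s;
    have /andP[] := vB s.
(* the variance is at most the second moment about [- m^2] *)
have le1 : distr_var p (fun s => - v s ^+ 2) <=
    \sum_s p s * (v s ^+ 2 - m ^+ 2) ^+ 2.
  rewrite /distr_var; set mu := distr_mean p (fun s => - v s ^+ 2).
  have -> : \sum_s p s * (v s ^+ 2 - m ^+ 2) ^+ 2 =
    \sum_s (p s * (- v s ^+ 2) ^+ 2 + 2 * m ^+ 2 * (p s * - v s ^+ 2) + m ^+ 2 ^+ 2 * p s).
    by apply: eq_bigr => s _; ring.
  rewrite !big_split /= -!mulr_sumr p1 -/(distr_mean p (fun s => - v s ^+ 2)) -/mu.
  rewrite -/(distr_mean p (fun s => (- v s ^+ 2) ^+ 2)).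
  by have := sqr_ge0 (mu + m ^+ 2); rewrite sqrrD; lra.
apply: le_trans le1 _; rewrite mulr_sumr; apply: ler_sum => s _.
rewrite [leRHS]mulrCA; apply: ler_wpM2l => //.
rewrite subr_sqr exprMn mulrC; apply: ler_wpM2r; first exact: sqr_ge0.
have -> : 4 * B ^+ 2 = (2 * B) ^+ 2 by ring.
by rewrite lerXn2r ?nnegrE //; have := vB s; lra.
Qed.

Lemma concentrated_prob s a (v : S -> R) (L : R) : 0 < L ->
  fprob (weight P (n := n) (K := K))
    (fun o => `[< ~ concentrated L n (P s a) (ehat R o s a) v >]) <= 2 * expR (- L).
Proof.
move=> L0; have nR : 0 < n%:R :> R by rewrite ltr0n.
have p0 := (kP s a).1; have p1 := (kP s a).2.
case: (lerP (L * (spnorm v + 1)) n%:R) => [LB|LB]; last first.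
  rewrite /fprob big_pred0 => [|o]; first by apply: mulr_ge0 => //; exact: expR_ge0.
  by apply/negbTE/negP => /asboolW; apply => ?; exfalso; lra.
have sv := spnorm_ge0 v.
pose B := spnorm v + 1; pose q := bernstein_rate L n v.
have B1 : 1 <= B by rewrite /B; lra.
have q0 : 0 < q by rewrite sqrtr_gt0 divr_gt0 // mulr_gt0 //; lra.
have q2 : q ^+ 2 = L * B / n%:R.
  by rewrite sqr_sqrtr // ltW // divr_gt0 // mulr_gt0 //; lra.
have /andP[_ q1] := bernstein_rate01 n0 LB.
set w := lowered v.
have wB y : 0 <= w y <= B.
  by rewrite lowered_ge0 /=; apply: le_trans (lowered_le _ _) _; rewrite /B; lra.
have m0 : 0 <= distr_mean (P s a) w.
  by apply: distr_mean_ge => // y; have /andP[] := wB y.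
(* [lam1] makes the additive term [2 * q]; [lam2] makes the variance coefficient 1/2 through
   [distr_var_sqr]. Both exponents stay below 1/2, the first because [q <= 1]. *)
pose lam1 := q / (2 * B); pose lam2 := (16 * B ^+ 2)^-1.
have B0 : 0 < B by lra.
have l1 : 0 < lam1 by apply: divr_gt0 => //; apply: mulr_gt0.
have l2 : 0 < lam2 by rewrite invr_gt0 mulr_gt0 // exprn_gt0.
have c1 := @chernoff R S A P n K kP n0 K0 s a w lam1 L l1.
have c2 := @chernoff R S A P n K kP n0 K0 s a (fun y => - w y ^+ 2) lam2 L l2.
have LE : L = q ^+ 2 * n%:R / B by rewrite q2; field; rewrite !gt_eqF.
have e1 : L / (n%:R * lam1) = 2 * q.
  by rewrite [in LHS]LE /lam1; field; rewrite !gt_eqF.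
have e2 : L / (n%:R * lam2) = 16 * q ^+ 2 * B.
  by rewrite [in LHS]LE /lam2; field; rewrite !gt_eqF.
have {}c1 := c1 _; have {}c2 := c2 _.
rewrite e1 in c1; rewrite e2 in c2.
rewrite mulr2n mulrDl mul1r.
apply: le_trans (lerD (c1 _) (c2 _)).
- apply: le_trans (fprobU (weight_ge0 kP) _ _).
  apply: (fprob_mono (weight_ge0 kP)) => o /asboolW nc.
  rewrite -[_ || _]negbK negb_or -!leNgt; apply/negP => /andP[h1 h2]; apply: nc => _.
  rewrite -/q -/B -/w; split; first exact: h1.
  rewrite !distr_meanN in h2.
  have vs := distr_var_sqr p0 p1 wB.
  have : 2 * lam2 * distr_var (P s a) (fun y => - w y ^+ 2) <=
      2 * lam2 * (4 * B ^+ 2 * distr_var (P s a) w).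
    by apply: ler_wpM2l => //; apply: mulr_ge0 => //; exact: ltW.
  have -> : 2 * lam2 * (4 * B ^+ 2 * distr_var (P s a) w) = distr_var (P s a) w / 2.
    by rewrite /lam2; field; rewrite !gt_eqF.
  by move: h2; clear; lra.
- move=> y; have /andP[_ wy] := wB y.
  apply: (@le_trans _ _ (lam1 * B)).
    by apply: ler_wpM2l; [exact: ltW | lra].
  have -> : lam1 * B = q / 2 by rewrite /lam1; field; rewrite !gt_eqF.
  by rewrite -/q in q1; lra.
move=> y.
have w2 z : 0 <= w z ^+ 2 <= B ^+ 2.
  by rewrite sqr_ge0 /= lerXn2r ?nnegrE //; have := wB z; lra.
apply: (@le_trans _ _ (lam2 * B ^+ 2)).
  apply: ler_wpM2l; first exact: ltW.
  have : distr_mean (P s a) (fun y => w y ^+ 2) <= B ^+ 2.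
    by apply: distr_mean_le => // z; have /andP[] := w2 z.
  by have := w2 y; rewrite distr_meanN; clear; lra.
have -> : lam2 * B ^+ 2 = 16^-1 by rewrite /lam2; field; rewrite !gt_eqF.
lra.
Qed.

End FixedVector.

(** * Leave-one-out models *)

(** The [d] equations pin [u] to within [6 * T / (1 - g)], as [Y] moves at most [g] times as fast as
    [u]. The [c] equations then allow [6 * T] plus [1 + g <= 2] times that width. *)
Lemma window_arith (R : realFieldType) (g T c c' d X X' Y Y' u u' : R) :
  0 <= g -> 0 < 1 - g ->
  `|c + X - u| <= 3 * T -> `|c' + X' - u'| <= 3 * T ->
  `|d + Y - u| <= 3 * T -> `|d + Y' - u'| <= 3 * T ->
  `|X - X'| <= g * `|u - u'| -> `|Y - Y'| <= g * `|u - u'| ->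
  `|c - c'| <= 18 * (T / (1 - g)).
Proof.
move=> g0 g1 h1 h2 h3 h4 la lb.
have uu : `|u - u'| <= 6 * (T / (1 - g)).
  have key : `|u - u'| <= 3 * T + 3 * T + g * `|u - u'|.
    have -> : u - u' = - (d + Y - u) + (d + Y' - u') + (Y - Y') by ring.
    apply: le_trans (ler_normD _ _) _; apply: lerD => //.
      by apply: le_trans (ler_normD _ _) _; apply: lerD => //; rewrite normrN.
    by apply: le_trans lb _; rewrite (_ : - _ + _ + _ = u - u') //; ring.
  rewrite mulrA ler_pdivlMr // mulrBr mulr1 (mulrC _ g).
  by move: key; clear; lra.
have T1 : T <= T / (1 - g).
  have T0 : 0 <= 3 * T := le_trans (normr_ge0 _) h1.
  rewrite ler_pdivlMr // -[leRHS]mulr1; apply: ler_wpM2l.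
    by move: T0; clear; lra.
  by move: g0; clear; lra.
have gN : g * `|u - u'| <= `|u - u'|.
  by rewrite -[leRHS]mul1r; apply: ler_wpM2r => //; move: g1; clear; lra.
have -> : c - c' = (c + X - u) + - (c' + X' - u') + - (X - X') + (u - u') by ring.
apply: (@le_trans _ _ (3 * T + 3 * T + g * `|u - u'| + `|u - u'|)).
  apply: le_trans (ler_normD _ _) _; apply: lerD => //.
  apply: le_trans (ler_normD _ _) _; apply: lerD; last by rewrite normrN.
  by apply: le_trans (ler_normD _ _) _; apply: lerD => //; rewrite normrN.
by move: gN uu T1; clear; lra.
Qed.

Section LeaveOneOut.
Variables (R : realType) (S A : finType).
Implicit Types (Q : S -> A -> S -> R) (r : S -> A -> R) (pi : S -> A).

(** A selection depending on nothing but the model, so equal models yield equal policies;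
    independence from the samples at [s] rests on this. *)
Definition optimal_policy (a0 : A) (g : R) Q r : S -> A :=
  xget (fun=> a0) [set pi | bellman g Q r pi (dval g Q r pi)].

Lemma optimal_policyP a0 g Q r : kernel_ok Q -> 0 <= g < 1 ->
  bellman g Q r (optimal_policy a0 g Q r) (dval g Q r (optimal_policy a0 g Q r)).
Proof.
move=> kQ g01; rewrite /optimal_policy.
have [pi hpi] := exists_optimal r a0 kQ g01.
exact: (@xgetPex _ (fun=> a0) [set pi | bellman g Q r pi (dval g Q r pi)] (ex_intro _ pi hpi)).
Qed.

(* In the model below the state [s] is absorbing and has value [u]. *)
Definition loo_kernel Q (s : S) : S -> A -> S -> R :=
  fun x a s' => if x == s then (s' == s)%:R else Q x a s'.

Definition loo_reward (g : R) r (s : S) (u : R) : S -> A -> R :=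
  fun x a => if x == s then (1 - g) * u else r x a.

Definition loo_policy a0 g Q r s u :=
  optimal_policy a0 g (loo_kernel Q s) (loo_reward g r s u).

Definition loo_value a0 g Q r s u :=
  dval g (loo_kernel Q s) (loo_reward g r s u) (loo_policy a0 g Q r s u).

Lemma qapp_loo Q s V a : qapp (loo_kernel Q s) V s a = V s.
Proof.
rewrite /qapp /mapp /loo_kernel eqxx (bigD1 s) //= eqxx mul1r big1 ?addr0 // => x.
by move=> /negbTE ->; rewrite mul0r.
Qed.

Lemma qapp_loo_neq Q s x V a : x != s -> qapp (loo_kernel Q s) V x a = qapp Q V x a.
Proof. by move=> /negbTE xs; rewrite /qapp /mapp /loo_kernel xs. Qed.

Lemma loo_ok Q s : kernel_ok Q -> kernel_ok (loo_kernel Q s).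
Proof.
move=> kQ x a; rewrite /loo_kernel; case: eqP => _; last exact: kQ.
split=> [s'|]; first by [].
by rewrite (bigD1 s) //= eqxx big1 ?addr0 // => s' /negbTE ->.
Qed.

(** Freezing [s] at its own optimal value leaves the optimal solution unchanged, so the unknown
    [V s] is the ideal choice of [u]. *)
Lemma bellman_loo g Q r pi V s : bellman g Q r pi V ->
  bellman g (loo_kernel Q s) (loo_reward g r s (V s)) pi V.
Proof.
case=> VE Vge; split=> [x|x a]; rewrite /loo_reward;
  case: (eqVneq x s) => [->|xs]; rewrite ?qapp_loo ?qapp_loo_neq //.
  by ring.
by rewrite le_eqVlt; apply/orP; left; apply/eqP; ring.
Qed.

Section Gap.
Variables (a0 : A) (g : R) (Q : S -> A -> S -> R) (r rt : S -> A -> R) (th : R).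
Hypothesis kQ : kernel_ok Q.
Hypothesis g01 : 0 <= g < 1.
Let T := th / (1 - g).
Let g0 : 0 <= g. Proof. by case/andP: g01. Qed.
Let g1 : 0 < 1 - g. Proof. by case/andP: g01 => _; rewrite subr_gt0. Qed.

Lemma loo_bellman s u : bellman g (loo_kernel Q s) (loo_reward g r s u)
  (loo_policy a0 g Q r s u) (loo_value a0 g Q r s u).
Proof. by apply: optimal_policyP => //; exact: loo_ok. Qed.

Lemma loo_value_lipschitz s u u' x :
  `|loo_value a0 g Q r s u x - loo_value a0 g Q r s u' x| <= `|u - u'|.
Proof.
have -> : `|u - u'| = ((1 - g) * `|u - u'|) / (1 - g) by field; rewrite gt_eqF.
apply: (bellman_dist x (loo_ok s kQ) g01 (loo_bellman s u) (loo_bellman s u')).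
move=> y a; rewrite /loo_reward; case: eqP => _.
  by rewrite -mulrBr normrM ger0_norm // ltW.
by rewrite subrr normr0 mulr_ge0 // ltW.
Qed.

Definition loo_action_value s u a : R := r s a + g * qapp Q (loo_value a0 g Q r s u) s a.

(** Quantifying over [u] avoids naming the value at [s], which depends on the rewards there. The
    absorbing model ignores those rewards, so [r s a] enters only through the action value of
    [a]. *)
Definition near_tie s a b : Prop := exists u,
  `|loo_action_value s u a - u| <= 3 * T /\ `|loo_action_value s u b - u| <= 3 * T.

(** [T] is the fixed point of [t -> th + g * t]: a reward error [th] and a value error [T] keep all
    values and action values within [T]. A disagreement at [x] would then be a near tie at [x]. *)
Lemma loo_policy_stable pi V s u x : 0 <= th ->
  (forall x a, `|rt x a - r x a| <= th) -> bellman g Q rt pi V ->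
  (forall x a b, a != b -> ~ near_tie x a b) ->
  `|u - V s| <= T -> x != s -> loo_policy a0 g Q r s u x = pi x.
Proof.
move=> th0 hr bV notie us xs; have [VE Vge] := bV.
have TE : th + g * T = T by rewrite /T; field; rewrite gt_eqF.
have ngT : (1 - g) * T = th by rewrite /T; field; rewrite gt_eqF.
have close y v z : `|v - V y| <= T -> `|V z - loo_value a0 g Q r y v z| <= T.
  move=> hv; apply: (bellman_dist z (loo_ok y kQ) g01 (bellman_loo y bV) (loo_bellman y v)).
  move=> z' a; rewrite /loo_reward; case: eqP => _; last exact: hr.
  rewrite -mulrBr normrM (ger0_norm (ltW g1)) distrC -ngT.
  by apply: ler_wpM2l => //; exact: ltW.
have closeq y v z a : `|v - V y| <= T ->
    `|(rt z a + g * qapp Q V z a) - (r z a + g * qapp Q (loo_value a0 g Q r y v) z a)| <= T.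
  move=> hv; rewrite opprD addrACA -mulrBr -[leRHS]TE.
  apply: le_trans (ler_normD _ _) _; apply: lerD; first exact: hr.
  rewrite normrM (ger0_norm g0); apply: ler_wpM2l => //.
  rewrite /qapp -mappB; apply: mapp_norm; first exact: stoch_row.
  by move=> z'; exact: close.
apply/eqP; rewrite -[_ == _]negbK; apply/negP => neq.
have [LE _] := loo_bellman s u.
set b := loo_policy a0 g Q r s u x in neq *.
have Lb := LE x; rewrite -/b qapp_loo_neq // {1}/loo_reward (negbTE xs) in Lb.
have T0 : 0 <= T by rewrite divr_ge0 // ltW.
have self y : `|V y - V y| <= T by rewrite subrr normr0.
apply: (notie x (pi x) b); first by rewrite eq_sym.
(* The tie is read in the model absorbing at [x], not at [s]. The action [b] incurs three errors of
   size [T]: to the action value under [rt], to the value at [x] in the model absorbing at [s], and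
   to [V x]. *)
exists (V x); rewrite /loo_action_value.
have T3 : T <= 3 * T by rewrite -[leLHS]mul1r; apply: ler_wpM2r => //; lra.
split.
  have h := closeq _ _ x (pi x) (self x); rewrite -VE distrC in h.
  exact: le_trans h T3.
have h1 := closeq _ _ x b (self x); have h2 := closeq _ _ x b us.
have h3 := close _ _ x us.
rewrite -Lb in h2.
set F := r x b + _ in h1 *; set Qb := rt x b + _ in h1 h2.
set Lx := loo_value _ _ _ _ _ _ _ in h2 h3.
have -> : F - V x = (F - Qb) + (Qb - Lx) + (Lx - V x) by ring.
have -> : 3 * T = T + T + T by ring.
apply: le_trans (ler_normD _ _) _; apply: lerD; last by rewrite distrC.
by apply: le_trans (ler_normD _ _) _; apply: lerD => //; rewrite distrC.
Qed.

(* [u |-> action value - u] is strictly monotone, so a near tie pins [u] down to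
   a window of width O(th / (1-g)^2), whatever the reward of [a] is. *)
Lemma near_tie_window s a b u u' (c c' : R) :
  `|c + g * qapp Q (loo_value a0 g Q r s u) s a - u| <= 3 * T ->
  `|c' + g * qapp Q (loo_value a0 g Q r s u') s a - u'| <= 3 * T ->
  `|loo_action_value s u b - u| <= 3 * T ->
  `|loo_action_value s u' b - u'| <= 3 * T ->
  `|c - c'| <= 18 * (T / (1 - g)).
Proof.
have lip d : `|g * qapp Q (loo_value a0 g Q r s u) s d -
               g * qapp Q (loo_value a0 g Q r s u') s d| <= g * `|u - u'|.
  rewrite -mulrBr normrM (ger0_norm g0); apply: ler_wpM2l => //.
  rewrite /qapp -mappB; apply: mapp_norm; first exact: stoch_row.
  by move=> z'; exact: loo_value_lipschitz.
move=> h1 h2 h3 h4; exact: (window_arith g0 g1 h1 h2 h3 h4 (lip a) (lip b)).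
Qed.

End Gap.

End LeaveOneOut.

(** * Probabilities of ties and deviations *)

Section Events.
Variables (R : realType) (S A : finType) (P : S -> A -> S -> R) (r : S -> A -> R).
Variables (n K : nat) (th : R) (a0 : A).
Hypothesis kP : kernel_ok P.
Hypothesis n0 : (0 < n)%N.
Hypothesis K0 : (0 < K)%N.
Hypothesis th0 : 0 < th.

Notation outcome := (outcome S A n K).
Notation g := (1 - n%:R^-1 : R).

(* [o.2 (s, a)] is the index of the cell of width [th] containing Delta(s,a). *)
Definition rdisc (o : outcome) : S -> A -> R :=
  fun s a => r s a + (o.2 (s, a))%:R * th.

(** The action of a leave-one-out policy at its absorbing state is arbitrary; it is overwritten by a
    prescribed one. *)
Definition switch (pi : S -> A) (s : S) (a : A) : S -> A :=
  fun x => if x == s then a else pi x.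

Definition tie_event s a b (o : outcome) : bool :=
  `[< near_tie a0 g (ehat R o) (rdisc o) th s a b >].

Definition deviation_event L s a u (o : outcome) : bool :=
  `[< ~ concentrated L n (P s a) (ehat R o s a)
     (dval g P r (switch (loo_policy a0 g (ehat R o) (rdisc o) s u) s a)) >].

Let g01 : 0 <= g < 1.
Proof. by have [i0 i1 _] := inv_natr_bounds R n0; rewrite subr_ge0 i1 /= ltrBlDr ltrDl. Qed.

Lemma ehat_ext (o o' : outcome) s a :
  (forall i, o.1 (s, a, i) = o'.1 (s, a, i)) -> ehat R o s a = ehat R o' s a.
Proof.
move=> h; apply/funext => s'; rewrite /ehat /empirical; congr (_%:R / _).
by apply: eq_card => i; rewrite !unfold_in /= h.
Qed.

(** The absorbing model discards the row of [s], so resampling at [(s, a)] changes neither the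
    policy nor its true value; for frozen other data, that value is a fixed vector. *)
Lemma deviation_event_prob L s a u : 0 < L ->
  fprob (weight P (n := n) (K := K)) (deviation_event L s a u) <= 2 * expR (- L).
Proof.
move=> L0.
apply: (@fprob_resample R _ (weight P (n := n) (K := K)) (weight_ge0 kP)
  (weight_sum1 n kP K0) (mixX (s, a))); [exact: mixXK | exact: weight_mixX | move=> y].
set v := dval g P r (switch (loo_policy a0 g (ehat R y) (rdisc y) s u) s a).
apply: le_trans (concentrated_prob kP n0 K0 s a v L0).
apply: (fprob_mono (weight_ge0 kP)) => o; rewrite /deviation_event.
have -> : ehat R (mixX (s, a) o y) s a = ehat R o s a.
  by apply: ehat_ext => i; rewrite ffunE eqxx.
have rd : rdisc (mixX (s, a) o y) = rdisc y by [].
have lk : loo_kernel (ehat R (mixX (s, a) o y)) s = loo_kernel (ehat R y) s.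
  apply/funext => x; apply/funext => b; rewrite /loo_kernel; case: eqP => // xs.
  apply: ehat_ext => i; rewrite ffunE; case: eqP => //= -[xs' _].
  by case: xs.
by rewrite /loo_policy lk rd.
Qed.

Lemma card_window (D : nat) (G : pred 'I_K) :
  (forall k k', G k -> G k' -> (k <= k' + D)%N) -> (#|G| <= D.+1)%N.
Proof.
move=> h; case: (pickP G) => [k0 Gk0|G0]; last by rewrite (eq_card0 G0).
have [k1 Gk1 min1] : exists2 k1, G k1 & forall k, G k -> (k1 <= k)%N.
  by case: (arg_minnP (fun k : 'I_K => nat_of_ord k) Gk0) => k1 Gk1 min1; exists k1.
rewrite cardE -(size_map (fun k : 'I_K => nat_of_ord k)) -(size_iota k1 D.+1).
apply: uniq_leq_size.
  by rewrite map_inj_uniq ?enum_uniq //; exact: val_inj.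
move=> x /mapP[k]; rewrite mem_enum => Gk ->.
by rewrite mem_iota min1 //= addnS ltnS h.
Qed.

(** Resample the cell index at [(s, a)] alone. As [1 - g = 1/n], a tie confines the reward to a
    window of width [18 * n^2 * th], hence to at most [18 * n^2 + 1 <= 19 * n^2] of the [K]
    cells. *)
Lemma tie_event_prob s a b : a != b ->
  fprob (weight P (n := n) (K := K)) (tie_event s a b)
    <= 19 * n%:R ^+ 2 / K%:R.
Proof.
move=> ab; have [i0 i1 ni] := inv_natr_bounds R n0.
have nR : 0 < n%:R :> R by rewrite ltr0n.
apply: (@fprob_resample R _ (weight P (n := n) (K := K)) (weight_ge0 kP)
  (weight_sum1 n kP K0) (mixD (s, a))); [exact: mixDK | exact: weight_mixD | move=> y].
pose T := th / (1 - g).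
pose G (k : 'I_K) : bool := `[< exists u,
  `|r s a + k%:R * th +
    g * qapp (ehat R y) (loo_value a0 g (ehat R y) (rdisc y) s u) s a - u| <= 3 * T /\
  `|loo_action_value a0 g (ehat R y) (rdisc y) s u b - u| <= 3 * T >].
have := fprob_uniform n kP K0 (s, a) G; move=> GE.
apply: (@le_trans _ _ (fprob (weight P (n := n) (K := K)) (fun o => G (o.2 (s, a))))).
  apply: (fprob_mono (weight_ge0 kP)) => o /asboolW[u [h1 h2]]; apply/asboolT.
  have lv : loo_value a0 g (ehat R (mixD (s, a) o y)) (rdisc (mixD (s, a) o y)) s u =
     loo_value a0 g (ehat R y) (rdisc y) s u.
    have lr : loo_reward g (rdisc (mixD (s, a) o y)) s u = loo_reward g (rdisc y) s u.
      apply/funext => x; apply/funext => c; rewrite /loo_reward; case: eqP => // xs.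
      rewrite /rdisc /= ffunE; case: eqP => // -[xs' _].
      by case: xs.
    have eh : ehat R (mixD (s, a) o y) = ehat R y by [].
    by rewrite /loo_value /loo_policy lr eh.
  exists u; split.
    by move: h1; rewrite /loo_action_value lv /rdisc /= ffunE eqxx.
  move: h2; rewrite /loo_action_value lv /rdisc /= ffunE.
  by rewrite xpair_eqE eqxx /= eq_sym (negbTE ab).
rewrite GE; apply: ler_wpM2r; first by rewrite invr_ge0.
have cG : (#|G| <= (18 * n ^ 2).+1)%N.
  apply: card_window => k k' /asboolW[u [h1 h3]] /asboolW[u' [h2 h4]].
  have := near_tie_window (ehat_ok R n0 y) g01 h1 h2 h3 h4.
  have -> : r s a + k%:R * th - (r s a + k'%:R * th) = (k%:R - k'%:R) * th by ring.
  have -> : 18 * (th / (1 - g) / (1 - g)) = 18 * n%:R ^+ 2 * th.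
    by field; rewrite gt_eqF //= opprB addrCA subrr addr0 gt_eqF.
  rewrite normrM (ger0_norm (ltW th0)) ler_pM2r //.
  move/(le_trans (ler_norm _)); rewrite lerBlDl.
  by rewrite -natrX -natrM -natrD ler_nat.
apply: (@le_trans _ _ (18 * n ^ 2).+1%:R); first by rewrite ler_nat.
rewrite -natr1 natrM natrX.
have : 1 <= n%:R ^+ 2 :> R by rewrite exprn_ege1 // ler1n.
by lra.
Qed.

End Events.

Section GoodOutcome.
Variables (R : realType) (S A : finType) (P : S -> A -> S -> R) (r : S -> A -> R).
Variables (n K N : nat) (th L : R) (a0 : A) (pistar : S -> A) (h : S -> R).
Hypothesis kP : kernel_ok P.
Hypothesis n0 : (0 < n)%N.
Hypothesis K0 : (0 < K)%N.
Hypothesis th0 : 0 < th.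
Hypothesis L1 : 1 <= L.

Notation outcome := (outcome S A n K).
Notation g := (1 - n%:R^-1 : R).

(** The grid step [n * th] equals [th / (1 - g)], the tolerance of [loo_policy_stable]. *)
Definition bad_outcome (o : outcome) : bool :=
  [exists t : S * A * A, (t.1.2 != t.2) && tie_event r th a0 t.1.1 t.1.2 t.2 o] ||
  ([exists t : S * A * 'I_N,
     deviation_event P r th a0 L t.1.1 t.1.2 (t.2%:R * (n%:R * th)) o] ||
   [exists s, `[< ~ concentrated L n (P s (pistar s)) (ehat R o s (pistar s))
                    (fun x => - h x) >]]).

Lemma bad_outcome_prob : fprob (weight P (n := n) (K := K)) bad_outcome <=
  #|S|%:R * #|A|%:R ^+ 2 * (19 * n%:R ^+ 2 / K%:R) +
  (#|S|%:R * #|A|%:R * N%:R + #|S|%:R) * (2 * expR (- L)).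
Proof.
have w0 := weight_ge0 kP (n := n) (K := K).
have L0 : 0 < L by exact: lt_le_trans ltr01 L1.
apply: le_trans (fprobU w0 _ _) _; apply: lerD.
  apply: le_trans (fprob_union w0 (fun t : S * A * A => fun o =>
    (t.1.2 != t.2) && tie_event r th a0 t.1.1 t.1.2 t.2 o)) _.
  apply: (@le_trans _ _ (\sum_(t : S * A * A) (19 * n%:R ^+ 2 / K%:R))); last first.
    rewrite sumr_const !card_prod -[_ *+ _]mulr_natl !natrM.
    by rewrite expr2 (mulrA #|S|%:R).
  apply: ler_sum => t _; case: (boolP (t.1.2 != t.2)) => [ne|eq].
    by apply: le_trans (tie_event_prob r a0 kP n0 K0 th0 t.1.1 ne); apply: fprob_mono.
  by rewrite /fprob big_pred0.
apply: le_trans (fprobU w0 _ _) _; rewrite mulrDl; apply: lerD.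
  apply: le_trans (fprob_union w0 (fun t : S * A * 'I_N =>
    deviation_event P r th a0 L t.1.1 t.1.2 (t.2%:R * (n%:R * th)))) _.
  apply: (@le_trans _ _ (\sum_(t : S * A * 'I_N) (2 * expR (- L)))); last first.
    by rewrite sumr_const !card_prod card_ord -[_ *+ _]mulr_natl !natrM.
  by apply: ler_sum => t _; apply: deviation_event_prob.
apply: le_trans (fprob_union w0 (fun s o =>
  `[< ~ concentrated L n (P s (pistar s)) (ehat R o s (pistar s))
                    (fun x => - h x) >])) _.
apply: (@le_trans _ _ (\sum_(s : S) (2 * expR (- L)))); last first.
  by rewrite sumr_const -[_ *+ _]mulr_natl.
by apply: ler_sum => s _; apply: concentrated_prob.
Qed.

Lemma good_outcome_concentrated (o : outcome) rt pihat s :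
  ~~ bad_outcome o -> 2 / th < N%:R ->
  (forall s a, rdisc r th o s a <= rt s a <= rdisc r th o s a + th) ->
  (forall s a, 0 <= rt s a <= 2) ->
  bellman g (ehat R o) rt pihat (dval g (ehat R o) rt pihat) ->
  concentrated L n (P s (pihat s)) (ehat R o s (pihat s)) (dval g P r pihat).
Proof.
rewrite !negb_or => /and3P[notie nodev _] hN rtd rt2 bV.
have [i0 i1 ni] := inv_natr_bounds R n0.
have nR : 0 < n%:R :> R by rewrite ltr0n.
have g01 : 0 <= g < 1 by rewrite subr_ge0 i1 /= ltrBlDr ltrDl.
have kE := ehat_ok R n0 o.
set V := dval g (ehat R o) rt pihat in bV.
have TE : th / (1 - g) = n%:R * th.
  by rewrite opprB addrCA subrr addr0 invrK mulrC.
have V0 : 0 <= V s.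
  rewrite -(mul0r (1 - g)^-1).
  apply: (min_principle s (det_stoch pihat kE) g01) => y.
  rewrite mapp_det addr0 /V [leRHS]dvalE // lerDr.
  by have /andP[] := rt2 y (pihat y).
have V2 : V s <= 2 * n%:R.
  have -> : 2 * n%:R = 2 / (1 - g) :> R by rewrite opprB addrCA subrr addr0 invrK.
  apply: (max_principle s (det_stoch pihat kE) g01) => y.
  rewrite mapp_det /V [leLHS]dvalE // addrC lerD2l.
  by have /andP[] := rt2 y (pihat y).
have nth : 0 < n%:R * th by exact: mulr_gt0.
(* Round [V s] down to the grid. Since [0 <= V s <= 2 * n], the index is at most [2 / th], hence
   below [N]. *)
pose x := V s / (n%:R * th).
have x0 : 0 <= x by rewrite divr_ge0 // ltW.
have xN : x < N%:R.
  apply: le_lt_trans hN; rewrite ler_pdivrMr // mulrA mulrAC mulfVK ?gt_eqF //.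
have /andP[tx xt] := truncn_itv x0.
have jN : (Num.truncn x < N)%N by rewrite -(ltr_nat R); exact: le_lt_trans xN.
pose u := (Num.truncn x)%:R * (n%:R * th).
have us : `|u - V s| <= th / (1 - g).
  have -> : V s = x * (n%:R * th) by rewrite /x mulfVK // gt_eqF.
  rewrite TE /u -mulrBl normrM (gtr0_norm nth) -[leRHS]mul1r.
  rewrite ler_pM2r // distrC ger0_norm ?subr_ge0 // lerBlDr addrC natr1.
  exact: ltW.
have stable y : y != s -> loo_policy a0 g (ehat R o) (rdisc r th o) s u y = pihat y.
  move=> ys.
  apply: (@loo_policy_stable R S A a0 g (ehat R o) (rdisc r th o) rt th kE g01
    pihat V s u y (ltW th0)) => //.
    move=> z a; have /andP[l1 l2] := rtd z a.
    by rewrite ger0_norm ?subr_ge0 // lerBlDl.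
  move=> z a b ab nt; move/existsPn: notie => /(_ (z, a, b)) /=.
  by rewrite ab /= => /negP; apply; apply/asboolT.
have sw : switch (loo_policy a0 g (ehat R o) (rdisc r th o) s u) s (pihat s) = pihat.
  by apply/funext => y; rewrite /switch; case: (eqVneq y s) => [->|/stable].
move/existsPn: nodev => /(_ (s, pihat s, Ordinal jN)) /=.
by rewrite /deviation_event -/u sw => /asboolPn/contrapT.
Qed.

End GoodOutcome.

(** * The good event *)

Section Constants.
Variable R : realType.

Lemma ln_ge_half (z : R) : 2 <= z -> 2^-1 <= ln z.
Proof.
move=> z2; rewrite -[leLHS]expRK ler_ln ?posrE ?expR_gt0 //; last lra.
apply: le_trans z2; apply: le_trans (expR_le_quadratic (lexx _)) _.
by rewrite expr2; lra.
Qed.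

(** The exponent 13 is 3 + 10: with [z] the argument of the logarithm, [z ^+ 3] dominates the
    polynomial size of the union over the grid, and [z ^+ 10 >= 1024] absorbs the numerical factor
    936. *)
Lemma parameter_choice (s a n delta xi : R) :
  1 <= s -> 1 <= a -> 1 <= n -> 0 < delta < 1 -> 0 < xi <= 1 ->
  2 <= s * a * n / (delta * xi) ->
  exists K N : nat, [/\ (0 < K)%N,
    s * a ^+ 2 * (19 * n ^+ 2 / K%:R) <= delta / 2, 2 / (xi / K%:R) < N%:R &
    (s * a * N%:R + s) * (2 * expR (- (13 * ln (s * a * n / (delta * xi))))) <= delta / 2].
Proof.
move=> s1 a1 n1 /andP[d0 d1] /andP[x0 x1] z2.
set z := s * a * n / (delta * xi) in z2 *.
have s0 : 0 < s by lra.
have a0 : 0 < a by lra.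
have n0 : 0 < n by lra.
have z0 : 0 < z by lra.
pose W := s * a ^+ 2 * n ^+ 2 / delta.
have W1 : 1 <= W.
  rewrite /W ler_pdivlMr // mul1r; apply: le_trans (ltW d1) _.
  by rewrite mulr_ege1 ?mulr_ege1 ?exprn_ege1.
pose K := (Num.truncn (38 * W)).+1.
have W38 : 0 <= 38 * W by lra.
have /andP[K1 K2] := truncn_itv W38; rewrite -/K in K2.
have K39 : K%:R <= 39 * W by rewrite /K -natr1; lra.
have KR1 : 1 <= K%:R :> R by rewrite ler1n.
have KR : 0 < K%:R :> R by lra.
have Kx : 1 <= K%:R / xi by rewrite ler_pdivlMr // mul1r; lra.
have KX0 : 0 <= 2 * (K%:R / xi) by lra.
pose N := (Num.truncn (2 * (K%:R / xi))).+1.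
have /andP[N1 N2] := truncn_itv KX0; rewrite -/N in N2.
have N3 : N%:R <= 3 * (K%:R / xi) by rewrite /N -natr1; lra.
have NR1 : 1 <= N%:R :> R by rewrite ler1n.
exists K, N; split => //.
- rewrite mulrA ler_pdivrMr //.
  have -> : s * a ^+ 2 * (19 * n ^+ 2) = 19 * (W * delta).
    by rewrite /W mulfVK ?gt_eqF //; ring.
  have := ler_wpM2l (ltW d0) (ltW K2); rewrite (mulrC W); lra.
- by rewrite invf_div.
rewrite expRN expRM_natl lnK ?posrE //.
have N4 : N%:R <= 117 * (W / xi).
  apply: le_trans N3 _; have : K%:R / xi <= 39 * W / xi.
    by apply: ler_wpM2r => //; rewrite invr_ge0 ltW.
  by rewrite -(mulrA 39); lra.
have sN : s <= s * a * N%:R.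
  rewrite -mulrA -[leLHS]mulr1; apply: ler_wpM2l; first lra.
  exact: mulr_ege1.
have z13 : 0 < z ^+ 13 by rewrite exprn_gt0.
rewrite mulrA ler_pdivrMr //.
have sa0 : 0 <= s * a by apply: mulr_ge0; lra.
apply: (@le_trans _ _ (468 * (s * a * (W / xi)))).
  by have := ler_wpM2l sa0 N4; rewrite -mulrA; lra.
pose F := s * n / (delta * xi ^+ 2).
have F1 : 1 <= F.
  rewrite /F ler_pdivlMr ?mul1r; last by rewrite mulr_gt0 // exprn_gt0.
  apply: (@le_trans _ _ 1); last exact: mulr_ege1.
  by apply: mulr_ile1; [lra | exact: exprn_ge0 (ltW _) | lra | exact: exprn_ile1 (ltW _) _].
have z3 : z ^+ 3 = s * a * (W / xi) / delta * F.
  by rewrite /z /W /F; field; rewrite !gt_eqF.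
have Y0 : 0 <= s * a * (W / xi) / delta.
  rewrite divr_ge0 ?(ltW d0) // mulr_ge0 // divr_ge0 ?(ltW x0) //; lra.
have Y3 : s * a * (W / xi) / delta <= z ^+ 3.
  by rewrite z3 -[leLHS]mulr1; apply: ler_wpM2l.
have z10 : 936 <= z ^+ 10.
  apply: (@le_trans _ _ (2 ^+ 10)); last by rewrite lerXn2r ?nnegrE //; lra.
  by have -> : 2 ^+ 10 = 1024 :> R; [ring | lra].
have -> : 468 * (s * a * (W / xi)) = delta / 2 * (936 * (s * a * (W / xi) / delta)).
  by field; rewrite !gt_eqF.
apply: ler_wpM2l; first lra.
have -> : z ^+ 13 = z ^+ 10 * z ^+ 3 by rewrite -exprD.
have gen c : 0 <= c -> c <= z ^+ 10 ->
    c * (s * a * (W / xi) / delta) <= z ^+ 10 * z ^+ 3.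
  by move=> c0 c1; exact: ler_pM.
by apply: gen z10; exact: ler0n.
Qed.

End Constants.

Section FinitePartition.
Variables (R : realType) (d : measure_display) (T : measurableType d).
Variable Pr : probability T R.

Lemma prob_bigcup_fin (O : finType) (F : O -> set T) (w : O -> R) (G : pred O) :
  (forall o, measurable (F o)) -> trivIset setT F ->
  (forall o, prob Pr (F o) = w o) ->
  prob Pr (\bigcup_(o in [set o | G o]) F o) = fprob w G.
Proof.
move=> mF tF wF.
have -> : [set o | G o] = [set` [seq o <- enum O | G o]].
  by apply/seteqP; split => o /=; rewrite mem_filter mem_enum andbT.
rewrite /prob measure_fin_bigcup //; last exact: sub_trivIset tF.
rewrite -fsbig_seq; last by rewrite filter_uniq // enum_uniq.
rewrite big_filter big_enum_cond /=.
under eq_bigr => o _.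
  rewrite -[Pr (F o)]fineK ?fin_num_measure // -[fine _]/(prob Pr (F o)) wF; over.
by rewrite sumEFin.
Qed.

End FinitePartition.

(** * Discretizing the samples and perturbations *)

Section Cells.
Variables (R : realType) (S A : finType) (d : measure_display).
Variables (T : measurableType d) (n K : nat).
Variables (X : S -> A -> 'I_n -> T -> S) (Delta : S -> A -> T -> R) (th : R).

Notation outcome := (outcome S A n K).

Definition slot (o : outcome) (s : S) (a : A) : set R :=
  [set` `[(o.2 (s, a))%:R * th, (o.2 (s, a)).+1%:R * th[].

(** Half-open slots keep the cells disjoint. A perturbation outside [[0, xi[] lies in no slot; the
    weights of the cells nevertheless sum to 1. *)
Definition cell (o : outcome) : set T :=
  \bigcap_(k in [set: S * A * 'I_n])
     (X k.1.1 k.1.2 k.2 @^-1` [set o.1 (k.1.1, k.1.2, k.2)]) `&`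
  \bigcap_(j in [set: S * A]) (Delta j.1 j.2 @^-1` slot o j.1 j.2).

Lemma cellP o w : cell o w ->
  (forall s a i, X s a i w = o.1 (s, a, i)) /\
  (forall s a, (o.2 (s, a))%:R * th <= Delta s a w < (o.2 (s, a)).+1%:R * th).
Proof.
case=> hX hD; split=> [s a i|s a]; first exact: (hX (s, a, i)).
by have := hD (s, a) Logic.I; rewrite /slot /= in_itv.
Qed.

Lemma trivIset_cell : 0 < th -> trivIset setT cell.
Proof.
move=> th0 o o' _ _ [w [/cellP[hX hD] /cellP[hX' hD']]].
case: o hX hD => x k hX hD; case: o' hX' hD' => x' k' hX' hD'.
rewrite /= in hX hD hX' hD' *; congr (_, _).
  by apply/ffunP => -[[s a] i]; rewrite -hX -hX'.
apply/ffunP => -[s a]; apply/val_inj/eqP; rewrite eqn_leq.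
have /andP[l1 l2] := hD s a; have /andP[l1' l2'] := hD' s a.
rewrite -ltnS -[X in _ && X]ltnS -(ltr_nat R) -[X in _ && X](ltr_nat R).
by rewrite -(ltr_pM2r th0) -[X in _ && X](ltr_pM2r th0) (le_lt_trans l1 l2')
  (le_lt_trans l1' l2).
Qed.

Lemma measurable_cell o :
  (forall s a i s', measurable (X s a i @^-1` [set s'])) ->
  (forall s a, measurable_fun setT (Delta s a)) -> measurable (cell o).
Proof.
move=> mX mD; apply: measurableI.
  by apply: fin_bigcap_measurable => [|k _]; [exact: finite_finset | exact: mX].
apply: fin_bigcap_measurable => [|j _]; first exact: finite_finset.
rewrite -[X in measurable X]setTI; apply: mD => //; exact: measurable_itv.
Qed.

Lemma uniform_slot (xi : R) o s a : 0 < xi -> (0 < K)%N -> th = xi / K%:R ->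
  fine (@lebesgue_measure R (slot o s a `&` `[0, xi])) / xi = K%:R^-1.
Proof.
move=> x0 K0 thE; have KR : 0 < K%:R :> R by rewrite ltr0n.
have th0 : 0 < th by rewrite thE divr_gt0.
have -> : slot o s a `&` `[0, xi] = slot o s a.
  apply/setIidPl => x; rewrite /slot /= !in_itv /= => /andP[l1 l2].
  rewrite (le_trans _ l1) ?mulr_ge0 ?(ltW th0) //=.
  apply: (le_trans (ltW l2)); rewrite -[leRHS](_ : K%:R * th = xi); last first.
    by rewrite thE mulrC mulfVK // gt_eqF.
  by apply: ler_wpM2r; [exact: ltW | rewrite ler_nat].
rewrite /slot lebesgue_measure_itv /= lte_fin ltr_pM2r // ltr_nat ltnSn.
rewrite -EFinB /= -mulrBl -natr1 addrAC subrr add0r mul1r thE.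
by rewrite mulrAC mulfV ?mul1r // gt_eqF.
Qed.

End Cells.

Lemma card_le1_eq (A : finType) (x y : A) : (#|A| <= 1)%N -> x = y.
Proof. by move=> /fintype_le1P h; apply: h. Qed.

(** No probability is left here: [anchor_bellman] makes [pihat w] optimal at discount [1 - 1/n],
    [pbias_anchor] replaces the anchored bias by the discounted value without changing its span, and
    the good outcome supplies the concentration. *)
Lemma suboptimality_event (R : realType) (S A : finType)
    (P : S -> A -> S -> R) (r : S -> A -> R) (n K N : nat) (s0 : S) (xi L : R)
    (T : Type) (X : S -> A -> 'I_n -> T -> S) (Delta : S -> A -> T -> R)
    (pihat : T -> S -> A) (pistar : S -> A) (a0 : A)
    (o : outcome S A n K) (w : T) (s : S) :
  kernel_ok P -> (forall s a, 0 <= r s a <= 1) -> weakly_communicating P ->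
  (0 < n)%N -> (0 < K)%N -> 0 < xi <= n%:R^-1 -> 1 <= L -> 2 / (xi / K%:R) < N%:R ->
  blackwell_optimal (anchor (n%:R^-1) s0 (empirical n (fun s a i => X s a i w)))
     (fun s a => r s a + Delta s a w) (pihat w) ->
  blackwell_optimal P r pistar ->
  (forall s a i, X s a i w = o.1 (s, a, i)) ->
  (forall s a, (o.2 (s, a))%:R * (xi / K%:R) <= Delta s a w
                 < (o.2 (s, a)).+1%:R * (xi / K%:R)) ->
  ~~ bad_outcome P r N (xi / K%:R) L a0 pistar (pbias P r (det pistar)) o ->
  let B := spnorm (pbias P r (det pistar))
           + spnorm (pbias (anchor (n%:R^-1) s0 P) r (det (pihat w))) + 1 in
  L * B <= n%:R ->
  pgain P r (det pistar) s - pgain P r (det (pihat w)) s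
    <= 82 * Num.sqrt (L * B / n%:R).
Proof.
move=> kP r01 wc n0 K0 /andP[x0 xn] L1 hN bhat bstar hX hD good B LB.
have [i0 i1 ni] := inv_natr_bounds R n0.
have i01 : 0 < (n%:R^-1 : R) <= 1 by rewrite i0 i1.
have KR : 0 < K%:R :> R by rewrite ltr0n.
set th := xi / K%:R in hN hD good *.
have th0 : 0 < th by rewrite divr_gt0.
have eE : empirical n (fun s a i => X s a i w) = ehat R o.
  apply/funext => x; apply/funext => a; apply/funext => y.
  rewrite /ehat /empirical; congr (_%:R / _).
  by apply: eq_card => i; rewrite !unfold_in /= hX.
rewrite eE in bhat.
have kE := ehat_ok R n0 o.
have bell := anchor_bellman i01 kE bhat.
pose rt x a := r x a + Delta x a w.
have Dn x a : 0 <= Delta x a w <= xi.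
  have /andP[l1 l2] := hD x a; apply/andP; split.
    by apply: le_trans l1; rewrite mulr_ge0 // ltW.
  apply: (le_trans (ltW l2)); have -> : xi = K%:R * th.
    by rewrite /th mulrC mulfVK // gt_eqF.
  by apply: ler_wpM2r; [exact: ltW | rewrite ler_nat].
have [c hc] := pbias_anchor s0 r (pihat w) i01 kP.
set V := dval (1 - n%:R^-1) P r (pihat w) in hc.
have BE : B = spnorm (pbias P r (det pistar)) + spnorm V + 1.
  rewrite /B (_ : pbias (anchor _ _ _) _ _ = fun x => V x + c) ?spnormD //.
  exact/funext.
rewrite BE in LB *.
apply: (@plugin_suboptimality R S A P (ehat R o) r rt pistar (pihat w)
  (pgain P r (det pistar) s) (pbias P r (det pistar)) n L s) => //.
- move=> x a; have /andP[d0 d1] := Dn x a; rewrite lerDl d0 lerD2l.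
  exact: le_trans xn.
- have sM := det_stoch pistar kP; apply/andP; split.
    apply: (@gain_ge _ _ _ _ (fun=> 0)) => // y.
    by rewrite mapp_cst // subrr add0r rmu_det; have /andP[] := r01 y (pistar y).
  by apply: gain_le => // y; rewrite rmu_det; have /andP[] := r01 y (pistar y).
- move=> x; rewrite (blackwell_gain_const s x kP wc bstar).
  have := bias_poisson (rmu r (det pistar)) x (det_stoch pistar kP).
  rewrite mapp_det -/(pgain P r (det pistar)) -/(pbias P r (det pistar)) rmu_det.
  by move=> ->; ring.
- move=> x; move: good; rewrite !negb_or => /and3P[_ _ /existsPn/(_ x)].
  by move=> /asboolPn/contrapT.
- move=> x; apply: (@good_outcome_concentrated R S A P r n K N th L a0 pistar
    (pbias P r (det pistar)) n0 th0 o rt (pihat w) x) => //.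
  + move=> y a; rewrite /rdisc -addrA !lerD2l; have /andP[l1 /ltW l2] := hD y a.
    by rewrite l1 /=; move: l2; rewrite -natr1 mulrDl mul1r.
  + move=> y a; have /andP[d0 d1] := Dn y a; have /andP[r0 r1] := r01 y a.
    by rewrite addr_ge0 //= (_ : 2 = 1 + 1) // lerD // (le_trans d1) // (le_trans xn).
Qed.

(** As [l >= 1/2], [l ^+ 3 >= l / 4], so [2^20] leaves [2^18] in front of [l], enough for
    [13 * 82 ^ 2]. If [13 * l * B > n] the right side is at least 1 and the bound is trivial. *)
Lemma rate_conversion (R : realType) (n : nat) (l B x : R) : (0 < n)%N ->
  2^-1 <= l -> 0 <= B -> x <= 1 ->
  (13 * l * B <= n%:R -> x <= 82 * Num.sqrt (13 * l * B / n%:R)) ->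
  x <= Num.sqrt ((2 ^ 20)%:R * l ^+ 3 / n%:R * B).
Proof.
move=> n0 l2 B0 x1 hx; have nR : 0 < n%:R :> R by rewrite ltr0n.
have CE : (2 ^ 20)%:R = 1024 * 1024 :> R by rewrite natrX; ring.
have Y0 : 0 <= l * B / n%:R by rewrite divr_ge0 ?mulr_ge0 // ?ler0n; lra.
have l3 : l * 4^-1 <= l ^+ 3.
  rewrite (_ : l ^+ 3 = l * (l * l)); last by ring.
  apply: ler_wpM2l; first lra.
  rewrite (_ : 4^-1 = 2^-1 * 2^-1 :> R); last by field.
  by apply: ler_pM => //; lra.
set Y := l * B / n%:R in Y0.
have rhs : 1024 * (256 * Y) <= (2 ^ 20)%:R * l ^+ 3 / n%:R * B.
  rewrite CE; set c := 1024.
  rewrite (_ : _ * B = c * c * (l ^+ 3 * (B / n%:R))); last by ring.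
  rewrite (_ : 256 * Y = c * (l * 4^-1 * (B / n%:R))); last first.
    by rewrite /Y /c; field; rewrite gt_eqF.
  have c0 : 0 <= c by exact: ler0n.
  rewrite mulrA; apply: ler_wpM2l; first exact: mulr_ge0.
  by apply: ler_wpM2r l3; rewrite divr_ge0 // ltW.
have Y1 : 13 * l * B / n%:R = 13 * Y by rewrite /Y; ring.
case: (lerP (13 * l * B) n%:R) => h.
  apply: le_trans (hx h) _; rewrite Y1.
  rewrite -[82](ger0_norm (ler0n R 82)) -sqrtr_sqr -sqrtrM ?sqr_ge0 // ler_wsqrtr //.
  apply: le_trans rhs; rewrite [leLHS](_ : _ = 82 * (82 * (13 * Y))); last by ring.
  lra.
apply: (le_trans x1); rewrite -[leLHS]sqrtr1 ler_wsqrtr //; apply: le_trans rhs.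
have : 1 <= 13 * Y by rewrite -Y1 ler_pdivlMr // mul1r ltW.
lra.
Qed.

Theorem mainTheorem5 :
  exists C : nat, (0 < C)%N /\
  forall (R : realType) (S A : finType)
    (P : S -> A -> S -> R) (r : S -> A -> R) (n : nat) (s0 : S) (xi : R)
    (d : measure_display) (T : measurableType d) (Pr : probability T R)
    (X : S -> A -> 'I_n -> T -> S) (Delta : S -> A -> T -> R)
    (pihat : T -> S -> A) (pistar : S -> A) (delta : R),
  kernel_ok P ->
  (forall s a, 0 <= r s a <= 1) ->
  weakly_communicating P ->
  (0 < n)%N ->
  0 < xi <= n%:R^-1 ->
  (* the samples and the perturbations are measurable *)
  (forall s a i s', measurable (X s a i @^-1` [set s'])) ->
  (forall s a, measurable_fun setT (Delta s a)) ->
  (* mutual independence of all the X s a i and Delta s a *)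
  (forall (B : S -> A -> 'I_n -> set S) (D : S -> A -> set R),
     (forall s a, measurable (D s a)) ->
     prob Pr (\bigcap_(k in [set: S * A * 'I_n]) (X k.1.1 k.1.2 k.2 @^-1` B k.1.1 k.1.2 k.2)
              `&` \bigcap_(j in [set: S * A]) (Delta j.1 j.2 @^-1` D j.1 j.2))
     = (\prod_(k : S * A * 'I_n) prob Pr (X k.1.1 k.1.2 k.2 @^-1` B k.1.1 k.1.2 k.2))
       * \prod_(j : S * A) prob Pr (Delta j.1 j.2 @^-1` D j.1 j.2)) ->
  (* X s a i ~ P(.|s,a) *)
  (forall s a i s', prob Pr (X s a i @^-1` [set s']) = P s a s') ->
  (* Delta s a ~ Uniform[0, xi] *)
  (forall s a (D : set R), measurable D ->
     prob Pr (Delta s a @^-1` D)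
     = fine (@lebesgue_measure R (D `&` `[0, xi])) / xi) ->
  (* pihat(w) is Blackwell-optimal for (anchored empirical kernel, r + Delta) *)
  (forall w, blackwell_optimal
     (anchor (n%:R^-1) s0 (empirical n (fun s a i => X s a i w)))
     (fun s a => r s a + Delta s a w) (pihat w)) ->
  blackwell_optimal P r pistar ->
  0 < delta < 1 ->
  exists E : set T, measurable E /\ 1 - delta <= prob Pr E /\
    forall w, E w -> forall s,
      pgain P r (det pistar) s - pgain P r (det (pihat w)) s
      <= Num.sqrt (C%:R * (ln ((#|S|%:R * #|A|%:R * n%:R) / (delta * xi))) ^+ 3
                   / n%:R
                   * (spnorm (pbias P r (det pistar))
                      + spnorm (pbias (anchor (n%:R^-1) s0 P) r (det (pihat w))) + 1)).
Proof.
exists (2 ^ 20)%N; split; first by rewrite expn_gt0.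
move=> R S A P r n s0 xi d T Pr X Delta pihat pistar delta.
move=> kP r01 wc n0 xin mX mD indep lawX lawD bhat bstar d01.
have sS : 1 <= #|S|%:R :> R by rewrite ler1n; apply/card_gt0P; exists s0.
(* With one action the two policies coincide. This case is split off because the argument of the
   logarithm could then be close to 1; with two actions it is at least 2. *)
case: (leqP #|A| 1) => [A1|A2].
  exists setT; split; first exact: measurableT.
  split; first by rewrite /prob probability_setT /=; lra.
  move=> w _ s; have -> : pihat w = pistar by apply/funext => x; exact: card_le1_eq.
  by rewrite subrr sqrtr_ge0.
have aA : 2 <= #|A|%:R :> R by rewrite ler_nat.
have nR1 : 1 <= n%:R :> R by rewrite ler1n.
have [i0 i1 ni] := inv_natr_bounds R n0.
have /andP[x0 xn] := xin; have /andP[dl0 dl1] := d01.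
have x1 : xi <= 1 by exact: le_trans xn i1.
have z2 : 2 <= #|S|%:R * #|A|%:R * n%:R / (delta * xi).
  rewrite ler_pdivlMr ?mulr_gt0 //.
  apply: (@le_trans _ _ 2).
    rewrite -[leRHS]mulr1; apply: ler_wpM2l => //.
    by apply: mulr_ile1 => //; exact: ltW.
  have s2 : 2 <= #|S|%:R * #|A|%:R :> R.
    by apply: le_trans aA _; rewrite -[leLHS]mul1r; apply: ler_wpM2r.
  by apply: le_trans s2 _; rewrite -[leLHS]mulr1; apply: ler_wpM2l => //; apply: mulr_ge0.
have A1 : 1 <= #|A|%:R :> R by lra.
have x01 : 0 < xi <= 1 by rewrite x0.
have [K [N [K0 hK hN hL]]] := parameter_choice sS A1 nR1 d01 x01 z2.
set l := ln _ in hL *.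
have l2 : 2^-1 <= l by exact: ln_ge_half.
have L1 : 1 <= 13 * l by lra.
pose th := xi / K%:R.
have th0 : 0 < th by rewrite divr_gt0 // ltr0n.
pose h := pbias P r (det pistar).
pose a0 := pistar s0.
pose bad := bad_outcome (n := n) (K := K) P r N th (13 * l) a0 pistar h.
pose F := cell (K := K) X Delta th.
have probF o : prob Pr (F o) = weight P o.
  rewrite /F /cell (indep (fun s a i => [set o.1 (s, a, i)]) (fun s a => slot th o s a));
    last by move=> s a; exact: measurable_itv.
  congr (_ * _); apply: eq_bigr => -[].
    by move=> [s a] i _; rewrite lawX.
  move=> s a _; rewrite lawD /=; last exact: measurable_itv.
  exact: uniform_slot.
have mF o : measurable (F o) by exact: measurable_cell.
have tF : trivIset setT F by exact: trivIset_cell.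
(* A finite union of cells, hence measurable even though [w |-> pihat w] is arbitrary. *)
exists (\bigcup_(o in [set o | ~~ bad o]) F o); split.
  by apply: fin_bigcup_measurable => // o _.
split.
  rewrite (prob_bigcup_fin (w := weight P (n := n) (K := K)) (fun o => ~~ bad o) mF tF probF).
  rewrite (fprobC (weight_sum1 n kP K0)) lerD2l lerN2.
  have pb := @bad_outcome_prob R S A P r n K N th (13 * l) a0 pistar h kP n0 K0 th0 L1.
  apply: (le_trans pb).
  by rewrite [leRHS](splitr delta); apply: lerD.
move=> w [ o /= good /cellP[hX hD]] s.
have sb v : 0 <= spnorm v := @spnorm_ge0 R S v.
apply: rate_conversion => //.
- by rewrite addr_ge0 // addr_ge0.
- have g1 : pgain P r (det pistar) s <= 1.
    apply: gain_le => [|y]; first exact: det_stoch.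
    by rewrite rmu_det; have /andP[] := r01 y (pistar y).
  have g0 : 0 <= pgain P r (det (pihat w)) s.
    apply: (@gain_ge _ _ _ _ (fun=> 0)) => [|y]; first exact: det_stoch.
    rewrite mapp_cst; last exact: det_stoch.
    by rewrite subrr add0r rmu_det; have /andP[] := r01 y (pihat w y).
  lra.
move=> LB; apply: (@suboptimality_event R S A P r n K N s0 xi (13 * l) T X Delta
  pihat pistar a0 o w s) => //.
Qed.
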